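(* The congruence subgroup $\Gamma(4)$ of level $4$ in $\mathrm{O}(4,1;\mathbb{Z})$ admits a congruence RFRS tower; that is, there is a RFRS tower $\{\Gamma_j\}_{j\ge 0}$ for $\Gamma_0=\Gamma(4)$ such that every $\Gamma_j$ is a congruence subgroup of $\mathrm{O}(4,1;\mathbb{Z})$.
   Context: $\mathrm{O}(4,1;\mathbb{Z})$ is the group of matrices $A\in \mathrm{GL}_5(\mathbb{Z})$ preserving the quadratic form with matrix $\mathrm{diag}(1,1,1,1,-1)$. For an integer $N\ge 1$, $\Gamma(N)$ denotes the congruence subgroup of level $N$, i.e., the subgroup of all elements of $\mathrm{O}(4,1;\mathbb{Z})$ congruent to the identity matrix modulo $N$. A congruence subgroup of $\mathrm{O}(4,1;\mathbb{Z})$ is a subgroup containing $\Gamma(N)$ for some $N\ge 1$. For a finitely generated group $\Gamma$, the rational commutator subgroup $\Gamma_r^{(1)}$ is the kernel of the natural map $\Gamma \to H_1(\Gamma;\mathbb{Z})\otimes_{\mathbb{Z}} \mathbb{Q}$. A RFRS tower for $\Gamma$ is a sequence $\{\Gamma_j\}_{j\ge 0}$ of finite index subgroups of $\Gamma$ with $\Gamma_0=\Gamma$, $\Gamma_{j+1}\le \Gamma_j$ for all $j$, $\bigcap_j \Gamma_j=\{1\}$, and $(\Gamma_j)_r^{(1)} \le \Gamma_{j+1}$ for all $j\ge 0$. *)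

(* Defs.v *)
From HB Require Import structures.
From mathcomp Require Import all_boot all_order all_algebra.
From mathcomp Require Import ring_quotient.
From mathcomp Require Import boolp classical_sets cardinality.
From mathcomp Require Import freeg.

Set Implicit Arguments.
Unset Strict Implicit.
Unset Printing Implicit Defensive.

Import GRing.Theory.
Local Open Scope ring_scope.
Local Open Scope classical_set_scope.

(* Throughout, a subgroup of a group G is a [groupClosed G]: boolean-valued
   predicates are no restriction, by [asbool]. *)

Section GeneratedSubgroup.
Variables (V : zmodType) (S : set V).

Definition zspan : {pred V} :=
  fun v => `[< forall H : {pred V},
    zmod_closed H -> (forall s, S s -> s \in H) -> v \in H >].

Fact zspan_closed : zmod_closed zspan.
Proof.
split; first by apply/asboolP => H [].
move=> x y /asboolP Sx /asboolP Sy; apply/asboolP => H HH SH.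
by apply: HH.2; [exact: Sx | exact: Sy].
Qed.

HB.instance Definition _ := GRing.isZmodClosed.Build V zspan zspan_closed.

Definition zquot : zmodType := Quotient.quot zspan.

Definition zproj (v : V) : zquot := (\pi_(Quotient.quot zspan) v)%qT.

End GeneratedSubgroup.

(* A (x) B over Z: the free abelian group on A * B modulo biadditivity. *)
Section Tensor.
Variables A B : zmodType.

Definition tensor_rel : set {freeg (A * B)%type} :=
  [set u | (exists a a' b, u = << (a + a', b) >> - << (a, b) >> - << (a', b) >>)
        \/ (exists a b b', u = << (a, b + b') >> - << (a, b) >> - << (a, b') >>)].

Definition tensor : zmodType := zquot tensor_rel.

Definition pure_tensor (a : A) (b : B) : tensor :=
  zproj tensor_rel << (a, b) >>.

End Tensor.

(* H_1(G; Z), computed by the bar complex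
   Z[G x G] --d2--> Z[G] --d1--> Z  with trivial coefficients, where
   d2 [x|y] = [y] - [x y] + [x] and d1 = 0. *)
Section FirstHomology.
Variable G : groupType.

Definition bar_boundary : set {freeg G} :=
  [set u | exists x y : G, u = << y >> - << (x * y)%g >> + << x >>].

Definition H1 : zmodType := zquot bar_boundary.

Definition hclass (x : G) : H1 := zproj bar_boundary << x >>.

Definition rational_commutator : set G :=
  [set x | pure_tensor (hclass x) (1 : rat) = 0].

End FirstHomology.

Section SubgroupType.
Variables (G : groupType) (H : groupClosed G).

Definition subgroup := {x : G | x \in H}.

HB.instance Definition _ := SubChoice.on subgroup.

Fact subgroup_closed : group_closed (mem H).
Proof.
by split=> [|x y Hx Hy]; [exact: gpred1 | apply: gpredM => //; exact: gpredVr].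
Qed.

HB.instance Definition _ :=
  SubChoice_isSubGroup.Build G (fun x => x \in H) subgroup subgroup_closed.

End SubgroupType.

Definition finite_index (G : groupType) (H K : groupClosed G) : Prop :=
  {subset H <= K} /\
  finite_set [set (fun h => (x * h)%g) @` [set` H] | x in [set` K]].

Record RFRS_tower (G : groupType) (Gam : groupClosed G)
    (T : nat -> groupClosed G) : Prop := {
  RFRS_start : T 0%N =i Gam;
  RFRS_finite_index : forall j, finite_index (T j) Gam;
  RFRS_decreasing : forall j, {subset T j.+1 <= T j};
  RFRS_trivial_cap : \bigcap_j [set` T j] = [set 1%g];
  RFRS_rational : forall j (x : subgroup (T j)),
    rational_commutator x -> val x \in T j.+1
}.

Definition lorentz_mx : 'M[int]_5 :=
  diag_mx (\row_j if j == ord_max then -1 else 1).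

Definition lorentz_form (x : 'cV[int]_5) : int := (x^T *m lorentz_mx *m x) 0 0.

Definition preserves_lorentz : {pred 'M[int]_5} := fun A =>
  (A \in unitmx) && `[< forall x, lorentz_form (A *m x) = lorentz_form x >].

Definition O41Z := {A : 'M[int]_5 | A \in preserves_lorentz}.

HB.instance Definition _ := SubChoice.on O41Z.

Fact O41Z_one_subproof : 1%:M \in preserves_lorentz.
Proof. by rewrite unfold_in unitmx1; apply/asboolP => x; rewrite mul1mx. Qed.

Fact O41Z_mul_subproof (A B : O41Z) : val A *m val B \in preserves_lorentz.
Proof.
case: A B => A /andP[uA /asboolP qA] [B /andP[uB /asboolP qB]] /=.
by rewrite unfold_in unitmx_mul uA uB; apply/asboolP => x; rewrite -mulmxA qA qB.
Qed.

Fact O41Z_inv_subproof (A : O41Z) : invmx (val A) \in preserves_lorentz.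
Proof.
case: A => A /andP[uA /asboolP qA] /=.
by rewrite unfold_in unitmx_inv uA; apply/asboolP => x; rewrite -qA mulKVmx.
Qed.

Definition O41Z_one : O41Z :=
  exist (fun M => M \in preserves_lorentz) 1%:M O41Z_one_subproof.
Definition O41Z_mul (A B : O41Z) : O41Z :=
  exist (fun M => M \in preserves_lorentz) _ (O41Z_mul_subproof A B).
Definition O41Z_inv (A : O41Z) : O41Z :=
  exist (fun M => M \in preserves_lorentz) _ (O41Z_inv_subproof A).

Fact O41Z_mulA : associative O41Z_mul.
Proof. by move=> A B C; apply/val_inj; rewrite /= mulmxA. Qed.
Fact O41Z_mul1 : left_id O41Z_one O41Z_mul.
Proof. by move=> A; apply/val_inj; rewrite /= mul1mx. Qed.
Fact O41Z_1mul : right_id O41Z_one O41Z_mul.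
Proof. by move=> A; apply/val_inj; rewrite /= mulmx1. Qed.
Fact O41Z_unitmx (A : O41Z) : val A \in unitmx.
Proof. by have /andP[] := valP A. Qed.
Fact O41Z_mulV : left_inverse O41Z_one O41Z_inv O41Z_mul.
Proof. by move=> A; apply/val_inj; rewrite /= mulVmx ?O41Z_unitmx. Qed.
Fact O41Z_Vmul : right_inverse O41Z_one O41Z_inv O41Z_mul.
Proof. by move=> A; apply/val_inj; rewrite /= mulmxV ?O41Z_unitmx. Qed.

HB.instance Definition _ := isGroup.Build O41Z
  O41Z_mulA O41Z_mul1 O41Z_1mul O41Z_mulV O41Z_Vmul.

Section PrincipalCongruence.
Variable N : nat.

Definition Gamma_pred : {pred O41Z} := fun A =>
  [forall i, forall j, (val A i j == (1%:M : 'M[int]_5) i j %[mod N])%Z].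

Fact Gamma_predP (A : O41Z) :
  reflect (forall i j, (N %| (val A - 1%:M) i j)%Z) (A \in Gamma_pred).
Proof.
apply: (iffP forallP) => [h i j|h i].
  by rewrite !mxE -eqz_mod_dvd; have /forallP/(_ j) := h i; rewrite !mxE.
by apply/forallP => j; rewrite eqz_mod_dvd; have := h i j; rewrite !mxE.
Qed.

Fact dvdz_mulmx (A B : 'M[int]_5) :
  (forall i j, (N %| A i j)%Z) -> forall i j, (N %| (A *m B) i j)%Z.
Proof. by move=> h i j; rewrite mxE rpred_sum // => k _; rewrite dvdz_mulr. Qed.

Fact Gamma_pred1 : 1%g \in Gamma_pred.
Proof. by apply/Gamma_predP => i j; rewrite subrr mxE dvdz0. Qed.

Fact Gamma_predM : mulg_closed Gamma_pred.
Proof.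
move=> A B /Gamma_predP hA /Gamma_predP hB; apply/Gamma_predP => i j.
have -> : val (A * B)%g - 1%:M = (val A - 1%:M) *m val B + (val B - 1%:M).
  by rewrite mulmxBl mul1mx addrA subrK.
by rewrite mxE rpredD ?hB // dvdz_mulmx.
Qed.

Fact Gamma_predV : invg_closed Gamma_pred.
Proof.
move=> A /Gamma_predP hA; apply/Gamma_predP => i j.
have -> : val (A^-1)%g - 1%:M = - ((val A - 1%:M) *m val (A^-1)%g).
  by rewrite mulmxBl mul1mx mulmxV ?O41Z_unitmx // opprB.
by rewrite mxE rpredN dvdz_mulmx.
Qed.

HB.instance Definition _ := isMulClosed.Build O41Z Gamma_pred Gamma_predM.
HB.instance Definition _ := isMul1Closed.Build O41Z Gamma_pred Gamma_pred1.
HB.instance Definition _ := isInvClosed.Build O41Z Gamma_pred Gamma_predV.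

Definition Gamma : groupClosed O41Z := Gamma_pred.

End PrincipalCongruence.

Definition congruence_subgroup (H : groupClosed O41Z) : Prop :=
  exists2 N : nat, (0 < N)%N & {subset Gamma N <= H}.

(* Main.v *)
Require Import Defs.
From HB Require Import structures.
From mathcomp Require Import all_boot all_order all_algebra zify ring.
From mathcomp Require Import ring_quotient boolp classical_sets.
From mathcomp Require Import cardinality fsbigop freeg.

Set Implicit Arguments.
Unset Strict Implicit.
Unset Printing Implicit Defensive.

Import Order.TTheory GRing.Theory Num.Theory.
Local Open Scope ring_scope.

(** Let s be the reflection of Q^5 in the norm 4 vector (1,1,1,1;0).  It does
    not preserve Z^5, but 2 s is integral, so s g s is integral for every g in
    Gamma(4), and s normalizes the reflection group of the ideal regular
    24-cell, whose 24 facets are orthogonal to the vectors of norm 1 with last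
    coordinate 1.  The tower is T_0 = Gamma(4) and
      T_(j+1) = the g in T_j such that s k g k^-1 s lies in T_j
                for every k in O(4,1;Z).
    Each T_j is normal in O(4,1;Z) and contains Gamma(4^(j+1)), hence it is a
    congruence subgroup and has finite index.

    The condition on rational commutators reduces, by induction on j and
    functoriality under conjugation, to the bottom step
    [sconj_rationally_trivial]: if g in Gamma(4) is killed by all homomorphisms
    from Gamma(4) to Z, then s g s is in Gamma(4).  A height descent
    ([orbit_face_word], [Gamma4_face_word]) writes g as a product of
    reflections in facets f_1, ..., f_m of the 24-cell, so that s g s is the
    product of the reflections in s f_1, ..., s f_m, and modulo 4 this product
    only depends on the parities of the sums over l of the products of two
    coordinates of s f_l ([word_gram]).  These parities count walls: a path
    from the base point p = (0,0,0,0;1) to g p crosses the images of the facets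
    f_l, and an invariant family of walls is crossed as many times, modulo 2,
    as it has members among the f_l.  Since a wall and its opposite differ
    modulo 4, such a family has a coorientation invariant under Gamma(4); the
    signed number of crossings is then a homomorphism to Z, and it has the
    parity of the unsigned number.  It vanishes at g, so all parities are even
    ([even_wall_crossings]).

    The intersection of the T_j is trivial because a suitable product h of s
    and a reflection in O(4,1;Z) halves the isotropic vector c = (0,0,0,1;1).
    For g in every T_j, conjugation by powers of h shows that the integer
    (g c, c) is divisible by every power of 4 ([tower_descent]), so it vanishes,
    so g c is proportional to c, and then equal to c because g is congruent to
    1 modulo 4.  By normality g fixes every image of c under O(4,1;Z), and these
    images span. *)

(** * Homomorphisms to the rationals kill the rational commutator subgroup *)

Lemma additive_zspan_eq0 (V W : zmodType) (S : set V) (f : {additive V -> W}) v :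
  (forall s, S s -> f s = 0) -> v \in zspan S -> f v = 0.
Proof.
move=> fS /asboolP/(_ (fun u => f u == 0)) h; apply/eqP/h => [|s /fS/eqP//].
split=> [|x y /eqP fx /eqP fy]; first by rewrite unfold_in raddf0.
by rewrite unfold_in raddfB fx fy subr0.
Qed.

Lemma zproj_eq (V : zmodType) (S : set V) (u v : V) :
  zproj S u = zproj S v -> u - v \in zspan S.
Proof. by move=> /eqP; rewrite /zproj -Quotient.idealrBE. Qed.

Lemma zproj0 (V : zmodType) (S : set V) : zproj S 0 = 0.
Proof. exact: raddf0. Qed.

HB.instance Definition _ (R : nzRingType) (K : choiceType) (M : lmodType R)
    (f : K -> M) :=
  GRing.isZmodMorphism.Build {freeg K / R} M (fglift f) (lift_is_additive f).

Section RationalCommutator.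
Variables (G : groupType) (phi : G -> rat).
Hypothesis phiM : forall x y : G, phi (x * y)%g = phi x + phi y.

(* [zmodule] makes the rationals a module over int, the ring of coefficients
   of the free abelian groups involved. *)
Let lphi : {freeg G} -> zmodule rat := fglift (phi : G -> zmodule rat).

Let H1_lift (h : H1 G) : zmodule rat := lphi (repr h).

Let H1_liftE u : H1_lift (zproj (@bar_boundary G) u) = lphi u :> zmodule rat.
Proof.
apply/eqP; rewrite -subr_eq0 /H1_lift /lphi -raddfB; apply/eqP.
apply: (@additive_zspan_eq0 _ _ (@bar_boundary G)); last first.
  by apply: zproj_eq; rewrite /zproj reprK.
move=> _ [x [y ->]]; rewrite /lphi raddfD raddfB /= !liftU !scale1r phiM.
by rewrite opprD addrCA subrr addr0 addNr.
Qed.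

Let H1_liftD h k : H1_lift (h + k) = H1_lift h + H1_lift k.
Proof.
rewrite -[h]reprK -[k]reprK -raddfD.
by rewrite -!/(zproj (@bar_boundary G) _) !H1_liftE /lphi raddfD.
Qed.

(** [phi] induces the additive map sending h (x) q to phi(h) q on the tensor
    product of H_1 with Q, whose value at x (x) 1 is phi(x). *)
Lemma rational_commutator_hom x : rational_commutator x -> phi x = 0.
Proof.
rewrite /rational_commutator /pure_tensor /=.
rewrite -(zproj0 (@tensor_rel (H1 G) rat)) => /zproj_eq; rewrite subr0.
pose psi (hq : H1 G * rat) : zmodule rat := H1_lift hq.1 * hq.2.
move=> /(@additive_zspan_eq0 _ _ _ (fglift psi)) h.
have: fglift psi << (hclass x, 1) >> = 0.
  apply: h => _ [[a [a' [b ->]]]|[a [b [b' ->]]]]; rewrite !raddfB /= !liftU !scale1r /psi /=.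
    by rewrite H1_liftD mulrDl -addrA -opprD subrr.
  by rewrite mulrDr -addrA -opprD subrr.
by rewrite liftU scale1r /psi /= mulr1 /hclass H1_liftE /lphi liftU scale1r.
Qed.
End RationalCommutator.

(** * Coordinates in Z^5 *)

Notation i0 := (@Ordinal 5 0 isT).
Notation i1 := (@Ordinal 5 1 isT).
Notation i2 := (@Ordinal 5 2 isT).
Notation i3 := (@Ordinal 5 3 isT).
Notation i4 := (@Ordinal 5 4 isT).
Notation vect := ('cV[int]_5).

Lemma ord5P (P : 'I_5 -> Prop) : P i0 -> P i1 -> P i2 -> P i3 -> P i4 -> forall i, P i.
Proof.
move=> P0 P1 P2 P3 P4 [[|[|[|[|[|k]]]]] // h];
  by rewrite (bool_irrelevance h isT).
Qed.

Lemma sum5 (V : nmodType) (F : 'I_5 -> V) :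
  \sum_i F i = F i0 + F i1 + F i2 + F i3 + F i4.
Proof.
rewrite !big_ord_recl big_ord0 addr0 !addrA.
by congr (F _ + F _ + F _ + F _ + F _); apply/val_inj.
Qed.

Lemma mulrr_ge0 (z : int) : 0 <= z * z.
Proof. by rewrite -expr2 sqr_ge0. Qed.

Lemma sum4_sqr_le0 (a b c d : int) : a * a + b * b + c * c + d * d <= 0 ->
  [/\ a = 0, b = 0, c = 0 & d = 0].
Proof.
have sq0 (z : int) : z * z <= 0 -> z = 0 by nia.
move: (mulrr_ge0 a) (mulrr_ge0 b) (mulrr_ge0 c) (mulrr_ge0 d) => a2 b2 c2 d2 h.
by split; apply: sq0; lia.
Qed.

Definition vec5 (a b c d t : int) : vect := \col_i nth 0 [:: a; b; c; d; t] i.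

Lemma vectP (x y : vect) : (forall i, x i 0 = y i 0) -> x = y.
Proof. by move=> h; apply/matrixP => i j; rewrite (ord1 j). Qed.

(** * The Lorentzian form *)

Definition ldot (x y : vect) : int := (x^T *m lorentz_mx *m y) 0 0.

Lemma ldotE x y : ldot x y =
  x i0 0 * y i0 0 + x i1 0 * y i1 0 + x i2 0 * y i2 0 + x i3 0 * y i3 0
  - x i4 0 * y i4 0.
Proof.
have E i : (x^T *m lorentz_mx) 0 i = x i 0 * (if i == ord_max then -1 else 1).
  by rewrite /lorentz_mx mul_mx_diag !mxE.
by rewrite /ldot mxE sum5 !E /= !mulr1 mulrN1 mulNr.
Qed.

Lemma ldotC x y : ldot x y = ldot y x.
Proof. by rewrite !ldotE; ring. Qed.
Lemma ldotDl x y z : ldot (x + y) z = ldot x z + ldot y z.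
Proof. by rewrite !ldotE !mxE; ring. Qed.
Lemma ldotBl x y z : ldot (x - y) z = ldot x z - ldot y z.
Proof. by rewrite !ldotE !mxE; ring. Qed.
Lemma ldotZl a x z : ldot (a *: x) z = a * ldot x z.
Proof. by rewrite !ldotE !mxE; ring. Qed.
Lemma ldotNl x z : ldot (- x) z = - ldot x z.
Proof. by rewrite !ldotE !mxE; ring. Qed.
Lemma ldotDr x y z : ldot z (x + y) = ldot z x + ldot z y.
Proof. by rewrite !ldotE !mxE; ring. Qed.
Lemma ldotBr x y z : ldot z (x - y) = ldot z x - ldot z y.
Proof. by rewrite !ldotE !mxE; ring. Qed.
Lemma ldotZr a x z : ldot z (a *: x) = a * ldot z x.
Proof. by rewrite !ldotE !mxE; ring. Qed.
Lemma ldotNr x z : ldot z (- x) = - ldot z x.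
Proof. by rewrite !ldotE !mxE; ring. Qed.

Definition ldot_lin := (ldotDl, ldotBl, ldotZl, ldotNl, ldotDr, ldotBr, ldotZr, ldotNr).

Lemma lorentz_formE x : lorentz_form x = ldot x x. Proof. by []. Qed.

Lemma ldot_mulmx (A : 'M[int]_5) : (forall x, lorentz_form (A *m x) = lorentz_form x) ->
  forall x y, ldot (A *m x) (A *m y) = ldot x y.
Proof.
move=> h x y; have := h (x + y).
rewrite !lorentz_formE mulmxDr !ldot_lin -!lorentz_formE !h (ldotC (A *m y)) (ldotC y).
by lia.
Qed.

Lemma lorentz_mxK : lorentz_mx *m lorentz_mx = 1%:M.
Proof.
by apply/matrixP; apply: ord5P => /=; apply: ord5P;
  rewrite /lorentz_mx mul_diag_mx !mxE /= ?mulr0 ?mulr1.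
Qed.

(** From A^T J A = J and J^2 = 1, the matrix J A^T J is an inverse of A. *)
Lemma lorentz_unitmx (A : 'M[int]_5) :
  (forall x, lorentz_form (A *m x) = lorentz_form x) -> A \in unitmx.
Proof.
move=> /ldot_mulmx h.
have entry (M : 'M[int]_5) i j :
    ((delta_mx i 0)^T *m M *m delta_mx j 0) (0 : 'I_1) (0 : 'I_1) = M i j.
  by rewrite trmx_delta -rowE -colE !mxE.
have gram : A^T *m lorentz_mx *m A = lorentz_mx.
  have tm (u : vect) : (A *m u)^T = u^T *m A^T by exact: trmx_mul.
  apply/matrixP => i j; rewrite -!entry -/(ldot _ _) -h /ldot tm.
  by move: (delta_mx i 0)^T (delta_mx j 0) => u w; rewrite !mulmxA.
suff: lorentz_mx *m (A^T *m lorentz_mx) *m A = 1%:M by move/mulmx1_unit => [].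
by rewrite -mulmxA gram lorentz_mxK.
Qed.

Lemma preservesP (A : 'M[int]_5) :
  reflect (forall x y, ldot (A *m x) (A *m y) = ldot x y) (A \in preserves_lorentz).
Proof.
apply: (iffP andP) => [[_ /asboolP] | h]; first exact: ldot_mulmx.
have h1 x : lorentz_form (A *m x) = lorentz_form x by rewrite !lorentz_formE h.
by split; [exact: lorentz_unitmx | apply/asboolP].
Qed.

Definition act (g : O41Z) (x : vect) : vect := val g *m x.

Lemma ldot_act (g : O41Z) x y : ldot (act g x) (act g y) = ldot x y.
Proof. by apply: preservesP; exact: valP. Qed.

Lemma actM (g h : O41Z) x : act (g * h)%g x = act g (act h x).
Proof. by rewrite /act mulmxA. Qed.

Lemma actK (g : O41Z) x : act g^-1%g (act g x) = x.
Proof. by rewrite -actM mulVg /act /= mul1mx. Qed.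

Lemma actVK (g : O41Z) x : act g (act g^-1%g x) = x.
Proof. by rewrite -actM mulgV /act /= mul1mx. Qed.

Lemma actZ g a x : act g (a *: x) = a *: act g x.
Proof. by rewrite /act scalemxAr. Qed.
Lemma actD g x y : act g (x + y) = act g x + act g y.
Proof. by rewrite /act mulmxDr. Qed.
Lemma ldot_actl (g : O41Z) x y : ldot (act g x) y = ldot x (act g^-1%g y).
Proof. by rewrite -[RHS](ldot_act g) actVK. Qed.

Lemma mulmx_ext (A B : 'M[int]_5) : (forall x : vect, A *m x = B *m x) -> A = B.
Proof.
move=> h; apply/matrixP => i j; move/matrixP/(_ i 0): (h (delta_mx j 0)).
by rewrite -!colE !mxE.
Qed.

Lemma O41Z_ext (g h : O41Z) : (forall x : vect, act g x = act h x) -> g = h.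
Proof. by move=> e; apply/val_inj/mulmx_ext. Qed.

(** * Reflections *)

(** The reflection in [e] when c (e, e) = 2; so c is 2 for the vectors of norm 1
    and 1 for those of norm 2. *)
Definition refl_mx (c : int) (e : vect) : 'M[int]_5 :=
  1%:M - c *: (e *m (e^T *m lorentz_mx)).

Lemma refl_mxE c e x : refl_mx c e *m x = x - (c * ldot e x) *: e.
Proof.
rewrite mulmxBl mul1mx -scalemxAl -mulmxA -scalerA; congr (_ - c *: _).
by rewrite [_ *m x]mx11_scalar mul_mx_scalar.
Qed.

Definition refl (c : int) (e : vect) : O41Z := insubd (1%g : O41Z) (refl_mx c e).

Lemma val_refl c e : c * ldot e e = 2 -> val (refl c e) = refl_mx c e.
Proof.
move=> ce; rewrite val_insubd; case: ifP => // /negP[]; apply/preservesP => x y.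
rewrite !refl_mxE !ldot_lin (ldotC x e).
transitivity (ldot x y + c * ldot e x * ldot e y * (c * ldot e e - 2)); first by ring.
by rewrite ce subrr mulr0 addr0.
Qed.

Lemma act_refl c e x : c * ldot e e = 2 -> act (refl c e) x = x - (c * ldot e x) *: e.
Proof. by move=> ce; rewrite /act val_refl // refl_mxE. Qed.

Lemma reflV c e : c * ldot e e = 2 -> (refl c e)^-1%g = refl c e.
Proof.
move=> ce; apply: mulg1_eq; apply/O41Z_ext => x.
rewrite actM !act_refl // !ldot_lin -addrA -opprD -scalerDl.
set k := (X in X *: e).
have -> : k = c * ldot e x * (2 - c * ldot e e) by rewrite /k; ring.
by rewrite ce subrr mulr0 scale0r subr0 /act /= mul1mx.
Qed.

(** * Conjugation by the half-integral reflection *)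

Definition sroot : vect := vec5 1 1 1 1 0.

(** Twice the reflection s in [sroot], to stay within integral matrices. *)
Definition Smx : 'M[int]_5 := 2%:M - sroot *m (sroot^T *m lorentz_mx).

Lemma SmxE x : Smx *m x = 2 *: x - ldot sroot x *: sroot.
Proof.
rewrite mulmxBl mul_scalar_mx -mulmxA.
by rewrite [_ *m x]mx11_scalar mul_mx_scalar.
Qed.

Lemma ldot_sroot : ldot sroot sroot = 4. Proof. by rewrite ldotE !mxE. Qed.

Lemma SmxK : Smx *m Smx = 4%:M.
Proof.
apply: mulmx_ext => x; rewrite -mulmxA !SmxE !ldot_lin ldot_sroot mul_scalar_mx.
by apply: vectP => i; rewrite !mxE; ring.
Qed.

Lemma Smx_adj x y : ldot (Smx *m x) y = ldot x (Smx *m y).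
Proof. by rewrite !SmxE !ldot_lin (ldotC x sroot); ring. Qed.

Lemma GammaP N (g : O41Z) :
  reflect (exists X : 'M[int]_5, val g = 1%:M + N%:Z *: X) (g \in Gamma N).
Proof.
apply: (iffP (Gamma_predP N g)) => [h|[X ->] i j].
  exists (\matrix_(i, j) ((val g - 1%:M) i j %/ N)%Z).
  apply/matrixP => i j; have := divzK (h i j); rewrite !mxE mulrC => ->.
  by rewrite addrC subrK.
by rewrite addrC addKr mxE dvdz_mulr.
Qed.

(** The conjugate s g s, meaningful when it is integral, as it is on Gamma(4)
    by [sconj_Gamma]. *)
Definition sconj (g : O41Z) : O41Z :=
  insubd (1%g : O41Z) (map_mx (fun z => (z %/ 4)%Z) (Smx *m val g *m Smx)).

(** s (1 + 4 N X) s = 1 + N (2 s) X (2 s). *)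
Lemma sconj_Gamma N g X : val g = 1%:M + (4 * N)%N%:Z *: X ->
  val (sconj g) = 1%:M + N%:Z *: (Smx *m X *m Smx).
Proof.
move=> gX; pose M := 1%:M + N%:Z *: (Smx *m X *m Smx).
have SgS : Smx *m val g *m Smx = 4 *: M.
  rewrite gX mulmxDr mulmxDl mulmx1 SmxK -scalemxAr -scalemxAl PoszM -scalerA.
  by rewrite /M scalerDr scalemx1.
have -> : val (sconj g) = map_mx (fun z => (z %/ 4)%Z) (4 *: M).
  rewrite val_insubd SgS; case: ifP => // /negP[]; apply/preservesP => x y.
  have -> : map_mx (fun z => (z %/ 4)%Z) (4 *: M) = M.
    by apply/matrixP => i j; rewrite !mxE mulKz.
  have E z : 4 *: (M *m z) = Smx *m (act g (Smx *m z)).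
    by rewrite scalemxAl -SgS !mulmxA.
  have SS u w : ldot (Smx *m u) (Smx *m w) = 4 * ldot u w.
    by rewrite Smx_adj mulmxA SmxK mul_scalar_mx ldotZr.
  suff: 16 * ldot (M *m x) (M *m y) = 16 * ldot x y by lia.
  transitivity (ldot (4 *: (M *m x)) (4 *: (M *m y))); first by rewrite !ldot_lin; ring.
  by rewrite !E SS ldot_act SS; ring.
by apply/matrixP => i j; rewrite !mxE mulKz.
Qed.

Lemma sconj_scale g : g \in Gamma 4 -> 4 *: val (sconj g) = Smx *m val g *m Smx.
Proof.
move=> /GammaP[X gX]; rewrite (@sconj_Gamma 1 _ X) // gX mulmxDr mulmxDl mulmx1 SmxK.
by rewrite -scalemxAr -scalemxAl scalerDr scalemx1 scale1r.
Qed.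

Lemma sconj_sub N g : g \in Gamma (4 * N) -> sconj g \in Gamma N.
Proof.
by move=> /GammaP[X gX]; apply/GammaP; exists (Smx *m X *m Smx); exact: sconj_Gamma.
Qed.

Lemma sconjM g h : g \in Gamma 4 -> h \in Gamma 4 ->
  sconj (g * h)%g = (sconj g * sconj h)%g.
Proof.
move=> gG hG; apply/val_inj.
have inj (A B : 'M[int]_5) : 16 *: A = 16 *: B -> A = B.
  by move=> /matrixP e; apply/matrixP => i j; move: (e i j); rewrite !mxE; exact: mulfI.
apply: inj; transitivity (4 *: (4 *: val (sconj (g * h)%g))); first by rewrite scalerA.
rewrite sconj_scale ?gpredM //=.
transitivity (4 *: val (sconj g) *m (4 *: val (sconj h))); last first.
  by rewrite -scalemxAl -scalemxAr scalerA.
rewrite !sconj_scale // !mulmxA -[_ *m Smx *m Smx]mulmxA SmxK.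
by rewrite mul_mx_scalar -!scalemxAl.
Qed.

Lemma sconj1 : sconj 1%g = 1%g.
Proof.
have G1 : (1%g : O41Z) \in Gamma 4 by exact: gpred1.
by apply: (mulgI (sconj 1%g)); rewrite -sconjM // !mulg1.
Qed.

Lemma sconjV g : g \in Gamma 4 -> sconj g^-1%g = (sconj g)^-1%g.
Proof.
by move=> gG; apply/esym/mulg1_eq; rewrite -sconjM ?gpredV // mulgV sconj1.
Qed.

Lemma GammaJ N (k g : O41Z) : g \in Gamma N -> (k * g * k^-1)%g \in Gamma N.
Proof.
move=> /GammaP[X gX]; apply/GammaP; exists (val k *m X *m val k^-1%g).
rewrite /= gX mulmxDr mulmxDl mulmx1 mulmxV ?O41Z_unitmx //.
by rewrite -scalemxAr -scalemxAl.
Qed.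

Lemma Gamma_dvd M N (g : O41Z) : (M %| N)%N -> g \in Gamma N -> g \in Gamma M.
Proof.
move=> /dvdnP[q ->] /GammaP[X gX]; apply/GammaP; exists (q%:Z *: X).
by rewrite gX scalerA -PoszM mulnC.
Qed.

(** * Facets of the 24-cell and words in their reflections *)

Definition basept : vect := vec5 0 0 0 0 1.

Lemma ldot_basept (e : vect) : ldot e basept = - e i4 0.
Proof. by rewrite ldotE !mxE /=; ring. Qed.

(** The 24 vectors with two spatial coordinates equal to 1 or -1: the outer
    normals of the ideal regular 24-cell centred at [basept]. *)
Definition face (f : vect) : bool := (f i4 0 == 1) && (ldot f f == 1).

Lemma faceP (f : vect) : reflect (f i4 0 = 1 /\ ldot f f = 1) (face f).
Proof. by apply: (iffP andP) => -[/eqP a /eqP b]. Qed.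

Definition word (fs : seq vect) : O41Z := foldr (fun f w => (refl 2 f * w)%g) 1%g fs.

(** The spatial part of the form, to which the Cauchy-Schwarz inequality
    applies. *)
Definition sdot (x y : vect) : int :=
  x i0 0 * y i0 0 + x i1 0 * y i1 0 + x i2 0 * y i2 0 + x i3 0 * y i3 0.

Lemma ldot_sdot x y : ldot x y = sdot x y - x i4 0 * y i4 0.
Proof. exact: ldotE. Qed.

Lemma sdot_cauchy x y : sdot x y * sdot x y <= sdot x x * sdot y y.
Proof.
rewrite /sdot; move: (x _ _) (x _ _) (x _ _) (x _ _) (y _ _) (y _ _) (y _ _) (y _ _).
move=> a b c d p q r s; rewrite -subr_ge0.
set l := (X in 0 <= X).
have -> : l = (a * q - b * p) ^+ 2 + (a * r - c * p) ^+ 2 + (a * s - d * p) ^+ 2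
  + (b * r - c * q) ^+ 2 + (b * s - d * q) ^+ 2 + (c * s - d * r) ^+ 2.
  by rewrite /l; ring.
by rewrite !addr_ge0 // sqr_ge0.
Qed.

Lemma face_sdot f : face f -> sdot f f = 2.
Proof. by move=> /faceP[f4]; rewrite ldot_sdot f4; lia. Qed.

Lemma face_ldot (f x : vect) : face f -> ldot f x = sdot f x - x i4 0.
Proof. by move=> /faceP[f4 _]; rewrite ldot_sdot f4 mul1r. Qed.

(** A reflection in O(4,1;Z) with a spacelike normal preserves the future sheet
    of the hyperboloid; for facets, this is an instance of Cauchy-Schwarz. *)
Lemma face_descent_pos (f x : vect) : face f -> ldot x x = -1 -> 0 < x i4 0 ->
  0 < x i4 0 - 2 * ldot f x.
Proof.
move=> ff; rewrite ldot_sdot face_ldot // => xx t0.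
have := sdot_cauchy f x; rewrite face_sdot //.
move: (sdot f x) (sdot x x) (x i4 0) xx t0 => s n t xx t0 c.
by nia.
Qed.

(** If every sum of two of a, b, c, d is at most t, then it is at most t - 1 by
    parity, and then the sum of the squares is at most (t - 1)^2 < t^2 - 1: with p
    the largest of the four numbers, the others are at most both p and
    t - 1 - p. *)
Lemma pair_exceeds (a b c d t : int) : 0 <= a -> 0 <= b -> 0 <= c -> 0 <= d -> 1 < t ->
  (2 %| a)%Z -> (2 %| b)%Z -> (2 %| c)%Z -> (2 %| d)%Z ->
  a * a + b * b + c * c + d * d = t * t - 1 ->
  [\/ t < a + b, t < a + c | t < a + d] \/ [\/ t < b + c, t < b + d | t < c + d].
Proof.
move=> a0 b0 c0 d0 t1 a2 b2 c2 d2 n.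
have odd_t : ~~ (2 %| t)%Z.
  apply/negP => /dvdzP[k tk].
  case/dvdzP: a2 b2 c2 d2 n tk => a' -> /dvdzP[b' ->] /dvdzP[c' ->] /dvdzP[d' ->] n tk.
  by rewrite tk in n; lia.
have key (p q r s : int) : 0 <= p -> 0 <= q -> 0 <= r -> 0 <= s ->
    q <= p -> r <= p -> s <= p -> p + q < t -> p + r < t -> p + s < t ->
    p * p + q * q + r * r + s * s = t * t - 1 -> False.
  move=> p0 q0 r0 s0 qp rp sp pq pr ps e.
  have mono (u v : int) : 0 <= u -> u <= v -> u * u <= v * v.
    by move=> u0 uv; apply: ler_pM.
  have [] : 2 * p <= t - 1 \/ t - 1 < 2 * p by lia.
    move=> /(mono (2 * p)) /=; rewrite mulr_ge0 // => /(_ isT) pt.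
    by move: (mono _ _ q0 qp) (mono _ _ r0 rp) (mono _ _ s0 sp); lia.
  move=> pt; have q1 : q <= t - 1 - p by lia.
  have r1 : r <= t - 1 - p by lia.
  have s1 : s <= t - 1 - p by lia.
  have pr1 : 0 <= (2 * p - (t - 1)) * (t - 1 - p) by apply: mulr_ge0; lia.
  by move: (mono _ _ q0 q1) (mono _ _ r0 r1) (mono _ _ s0 s1); lia.
have lt (p q : int) : (2 %| p)%Z -> (2 %| q)%Z -> p + q <= t -> p + q < t.
  by move=> /dvdzP[p' ->] /dvdzP[q' ->]; lia.
case: (ltP t (a + b)) => [h|/(lt _ _ a2 b2) ab]; first by left; constructor 1.
case: (ltP t (a + c)) => [h|/(lt _ _ a2 c2) ac]; first by left; constructor 2.
case: (ltP t (a + d)) => [h|/(lt _ _ a2 d2) ad]; first by left; constructor 3.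
case: (ltP t (b + c)) => [h|/(lt _ _ b2 c2) bc]; first by right; constructor 1.
case: (ltP t (b + d)) => [h|/(lt _ _ b2 d2) bd]; first by right; constructor 2.
case: (ltP t (c + d)) => [h|/(lt _ _ c2 d2) cd]; first by right; constructor 3.
exfalso.
have [[h1 h2 h3]|[h1 h2 h3]|[h1 h2 h3]|[h1 h2 h3]] :
    [\/ [/\ b <= a, c <= a & d <= a], [/\ a <= b, c <= b & d <= b],
        [/\ a <= c, b <= c & d <= c] | [/\ a <= d, b <= d & c <= d]].
  have [p|p|p|p] : [\/ [&& b <= a, c <= a & d <= a], [&& a <= b, c <= b & d <= b],
        [&& a <= c, b <= c & d <= c] | [&& a <= d, b <= d & c <= d]] by apply/or4P; lia.
  - by constructor 1; apply/and3P.
  - by constructor 2; apply/and3P.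
  - by constructor 3; apply/and3P.
  - by constructor 4; apply/and3P.
- by apply: (key a b c d); rewrite //; lia.
- by apply: (key b a c d); rewrite //; lia.
- by apply: (key c a b d); rewrite //; lia.
- by apply: (key d a b c); rewrite //; lia.
Qed.

(** The sign of an integer, with value 1 at 0 so that two signs are always the
    spatial coordinates of a facet. *)
Definition pm_sign (z : int) : int := if z < 0 then -1 else 1.

(** The facet is chosen with its two nonzero spatial coordinates at the pair
    found by [pair_exceeds], with the signs of the coordinates of [x]. *)
Lemma exists_face (x : vect) : ldot x x = -1 -> 1 < x i4 0 ->
  (forall i, i != i4 -> (2 %| x i 0%R)%Z) -> exists2 f, face f & 0 < ldot f x.
Proof.
move=> xx t1 ev.
have xx' := xx; rewrite ldotE in xx'.
have sgE z : pm_sign z * z = `|z| by rewrite /pm_sign; case: ifP; lia.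
have sg2 z : pm_sign z * pm_sign z = 1 by rewrite /pm_sign; case: ifP.
have wit (f : vect) : ldot f f = 1 -> f i4 0 = 1 -> 0 < ldot f x ->
    exists2 f, face f & 0 < ldot f x.
  by move=> f1 f2 f3; exists f => //; apply/faceP.
have E (a b c d : int) : ldot (vec5 a b c d 1) x =
   a * x i0 0 + b * x i1 0 + c * x i2 0 + d * x i3 0 - x i4 0.
  by rewrite ldotE !mxE /= mul1r.
have N (a b c d : int) : ldot (vec5 a b c d 1) (vec5 a b c d 1) =
   a * a + b * b + c * c + d * d - 1.
  by rewrite ldotE !mxE /= mul1r.
have T (a b c d : int) : vec5 a b c d 1 i4 0 = 1 by rewrite mxE.
have dv i : i != i4 -> (2 %| `|x i 0%R|)%Z by move=> /ev; rewrite !dvdzE.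
have nrm (z : int) : `|z| * `|z| = z * z by rewrite -expr2 real_normK ?num_real // expr2.
pose s i := pm_sign (x i 0).
have := @pair_exceeds `|x i0 0| `|x i1 0| `|x i2 0| `|x i3 0| (x i4 0).
move=> /(_ (normr_ge0 _) (normr_ge0 _) (normr_ge0 _) (normr_ge0 _) t1).
move=> /(_ (dv i0 isT) (dv i1 isT) (dv i2 isT) (dv i3 isT)).
case=> [|[h|h|h]|[h|h|h]]; first by rewrite !nrm; lia.
- by apply: (wit (vec5 (s i0) (s i1) 0 0 1)); rewrite ?N ?T ?E ?sgE ?sg2 ?mul0r; lia.
- by apply: (wit (vec5 (s i0) 0 (s i2) 0 1)); rewrite ?N ?T ?E ?sgE ?sg2 ?mul0r; lia.
- by apply: (wit (vec5 (s i0) 0 0 (s i3) 1)); rewrite ?N ?T ?E ?sgE ?sg2 ?mul0r; lia.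
- by apply: (wit (vec5 0 (s i1) (s i2) 0 1)); rewrite ?N ?T ?E ?sgE ?sg2 ?mul0r; lia.
- by apply: (wit (vec5 0 (s i1) 0 (s i3) 1)); rewrite ?N ?T ?E ?sgE ?sg2 ?mul0r; lia.
- by apply: (wit (vec5 0 0 (s i2) (s i3) 1)); rewrite ?N ?T ?E ?sgE ?sg2 ?mul0r; lia.
Qed.

Lemma face_refl f : face f -> 2 * ldot f f = 2.
Proof. by move=> /faceP[_ ->]. Qed.

(** Descent on the last coordinate: reflecting in a facet that separates [x]
    from the base point decreases it. *)
Lemma orbit_face_word (x : vect) : ldot x x = -1 -> 0 < x i4 0 ->
    (forall i, i != i4 -> (2 %| x i 0%R)%Z) ->
  exists2 fs, all face fs & x = act (word fs) basept.
Proof.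
have [n] := ubnP `|x i4 0%R|%N; elim: n x => // n IH x xn xx t0 ev.
case: (ltP 1 (x i4 0)) => [t1|t1]; last first.
  have t : x i4 0 = 1 by lia.
  exists [::] => //; rewrite /act mul1mx.
  move: xx; rewrite ldotE t => xx.
  have /sum4_sqr_le0[z0 z1 z2 z3] :
      x i0 0 * x i0 0 + x i1 0 * x i1 0 + x i2 0 * x i2 0 + x i3 0 * x i3 0 <= 0.
    by lia.
  by apply: vectP; apply: ord5P; rewrite [RHS]mxE.
have [f ff fx] := exists_face xx t1 ev.
have y4 : (x - (2 * ldot f x) *: f) i4 0 = x i4 0 - 2 * ldot f x.
  by rewrite !mxE; move/faceP: ff => [-> _]; rewrite mulr1.
have pos := face_descent_pos ff xx t0.
have [|||| fs afs] := IH (act (refl 2 f) x).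
- by rewrite act_refl ?face_refl // y4; lia.
- by rewrite ldot_act.
- by rewrite act_refl ?face_refl // y4.
- move=> i ni; rewrite act_refl ?face_refl //.
  have /dvdzP[q xi] := ev i ni; apply/dvdzP.
  by exists (q - ldot f x * f i 0); rewrite !mxE xi; ring.
move=> e; exists (f :: fs); first by rewrite /= ff.
by rewrite actM -e -{1}(reflV (face_refl ff)) actK.
Qed.

Lemma basept_delta : basept = delta_mx i4 0.
Proof. by apply: vectP; apply: ord5P; rewrite !mxE. Qed.

Lemma act_delta (g : O41Z) a b : act g (delta_mx b 0) a 0 = val g a b.
Proof. by rewrite /act -colE mxE. Qed.

(** * Products of reflections modulo 4 *)

Definition gram (fs : seq vect) (a b : 'I_5) : int := \sum_(f <- fs) f a 0 * f b 0.

Lemma gram_cons f fs a b : gram (f :: fs) a b = f a 0 * f b 0 + gram fs a b.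
Proof. by rewrite /gram big_cons. Qed.

(** Modulo 4 the reflection in a vector f of norm 1 is 1 + 2 f f^T, since J = 1
    modulo 2, and the products of the terms 2 f f^T vanish.  [Y] is the
    quotient by 4 of the error. *)
Lemma word_gram fs : {in fs, forall f, ldot f f = 1} ->
  exists Y : 'I_5 -> 'I_5 -> int, forall a b,
    val (word fs) a b = (a == b)%:R + 2 * gram fs a b + 4 * Y a b.
Proof.
elim: fs => [|f fs IH] h.
  by exists (fun _ _ => 0) => a b; rewrite /gram big_nil !mxE; ring.
have [|Y e] := IH; first by move=> g gf; apply: h; rewrite inE gf orbT.
have f1 : ldot f f = 1 by apply: h; rewrite inE eqxx.
have f2 : 2 * ldot f f = 2 by rewrite f1.
have R x : act (refl 2 f) x = x - (2 * ldot f x) *: f by apply: act_refl.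
pose Y' a b := Y a b - f a 0 * (gram fs i0 b * f i0 0 + gram fs i1 b * f i1 0
   + gram fs i2 b * f i2 0 + gram fs i3 b * f i3 0 - gram fs i4 b * f i4 0
   + 2 * (Y i0 b * f i0 0 + Y i1 b * f i1 0 + Y i2 b * f i2 0 + Y i3 b * f i3 0 - Y i4 b * f i4 0))
   - (b != i4)%:R * f a 0 * f b 0.
exists Y' => a b.
rewrite -act_delta.
rewrite actM R gram_cons ldotE.
have ew c : act (word fs) (delta_mx b 0) c 0 = (c == b)%:R + 2 * gram fs c b + 4 * Y c b.
  by rewrite -e act_delta.
rewrite [LHS]mxE [X in _ + X]mxE [X in _ - X]mxE !ew /Y'.
move: (Y a b) (gram fs a b) (f a 0) (a == b) => ya ga fa ab.
by move: b {ew}; apply: ord5P => /=; ring.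
Qed.

Lemma word_Gamma2 fs : all face fs -> word fs \in Gamma 2.
Proof.
elim: fs => [_|f fs IH /= /andP[ff /IH h]]; first exact: gpred1.
apply: gpredM => //; apply/GammaP; exists (- (f *m (f^T *m lorentz_mx))).
by rewrite val_refl ?face_refl // /refl_mx scalerN.
Qed.

Lemma sqz_parity (z : int) : exists k, z * z = z + 2 * k.
Proof.
have [q [->|->]] : exists q, z = 2 * q \/ z = 2 * q + 1 by exists (z %/ 2)%Z; lia.
  by exists (2 * q * q - q); ring.
by exists (2 * q * q + q); ring.
Qed.

Lemma gram_diag fs a : all face fs -> (2 %| gram fs a a - gram fs a i4)%Z.
Proof.
elim: fs => [|f fs IH] /=; first by rewrite /gram !big_nil.
case/andP => /faceP[f4 _] /IH /dvdzP[q e]; rewrite !gram_cons f4.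
have [k fk] := sqz_parity (f a 0%R); apply/dvdzP; exists (q + k).
by rewrite fk; lia.
Qed.

(** A facet has f_4 = 1 and exactly two odd spatial coordinates, so it adds 1 to
    the first term and an odd number to the second one. *)
Lemma gram_time fs : all face fs ->
  (2 %| gram fs i4 i4 + (gram fs i0 i1 + gram fs i0 i2 + gram fs i0 i3 + gram fs i1 i2
         + gram fs i1 i3 + gram fs i2 i3))%Z.
Proof.
elim: fs => [|f fs IH] /=; first by rewrite /gram !big_nil.
case/andP => ff /IH /dvdzP[q e]; rewrite !gram_cons.
have [f4 _] := faceP _ ff; have := face_sdot ff; rewrite /sdot f4.
have [k0 e0] := sqz_parity (f i0 0%R); have [k1 e1] := sqz_parity (f i1 0%R).
have [k2 e2] := sqz_parity (f i2 0%R); have [k3 e3] := sqz_parity (f i3 0%R).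
move: e0 e1 e2 e3; move: (f i0 0%R) (f i1 0%R) (f i2 0%R) (f i3 0%R) => a b c d e0 e1 e2 e3 s.
pose t := 1 - k0 - k1 - k2 - k3.
have st : a + b + c + d = 2 * t by rewrite /t; lia.
have sq : (a + b + c + d) * (a + b + c + d) = 4 * (t * t) by rewrite st; ring.
have p : 1 + (a * b + a * c + a * d + b * c + b * d + c * d) = 2 * (t * t) by lia.
by apply/dvdzP; exists (q + t * t); lia.
Qed.

(** The columns other than the last are orthogonal to the time axis and of norm 1,
    with an odd diagonal entry, which leaves no room for another nonzero one. *)
Lemma axis_diagonal (d : O41Z) (eps : int) : d \in Gamma 2 -> eps * eps = 1 ->
  act d basept = eps *: basept ->
  (forall a b, a != b -> val d a b = 0) /\ (forall b, val d b b * val d b b = 1).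
Proof.
move=> /GammaP[X dX] eps1 dt.
have last b : eps * val d i4 b = (b == i4)%:R.
  have := ldot_act d (delta_mx b 0) basept.
  rewrite dt ldotZr !ldot_basept act_delta mxE eqxx andbT (eq_sym i4) => h.
  by apply: oppr_inj; rewrite -h; ring.
have last0 b : b != i4 -> val d i4 b = 0.
  move=> /negPf nb; have := last b; rewrite nb => h.
  by rewrite -[LHS]mul1r -eps1 -mulrA h mulr0.
have col4 a : val d a i4 = eps * basept a 0.
  by rewrite -act_delta -basept_delta dt mxE.
have nrm b : b != i4 -> val d i0 b * val d i0 b + val d i1 b * val d i1 b
   + val d i2 b * val d i2 b + val d i3 b * val d i3 b = 1.
  move=> nb; have := ldot_act d (delta_mx b 0) (delta_mx b 0).
  rewrite [LHS]ldotE !act_delta last0 // mul0r subr0 => ->.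
  by rewrite ldotE !mxE; move: b nb; apply: ord5P.
have odd a b : exists x, val d a b = (a == b)%:R + 2 * x.
  by exists (X a b); rewrite dX !mxE.
have z (x a b c : int) : (1 + 2 * x) * (1 + 2 * x) + a * a + b * b + c * c = 1 ->
    [/\ a = 0, b = 0, c = 0 & (1 + 2 * x) * (1 + 2 * x) = 1].
  move=> h; have : 0 < (1 + 2 * x) * (1 + 2 * x) by nia.
  by move=> h1; split; nia.
have dg b : b != i4 -> [/\ forall a, a != b -> val d a b = 0 & val d b b * val d b b = 1].
  move=> nb; have := nrm b nb; have := last0 b nb; have [x] := odd b b; rewrite eqxx.
  move: b nb; apply: ord5P => // _ -> h4 h.
  - have [|z1 z2 z3 ->] := z x (val d i1 i0) (val d i2 i0) (val d i3 i0); first by lia.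
    by split=> //; apply: ord5P.
  - have [|z1 z2 z3 ->] := z x (val d i0 i1) (val d i2 i1) (val d i3 i1); first by lia.
    by split=> //; apply: ord5P.
  - have [|z1 z2 z3 ->] := z x (val d i0 i2) (val d i1 i2) (val d i3 i2); first by lia.
    by split=> //; apply: ord5P.
  - have [|z1 z2 z3 ->] := z x (val d i0 i3) (val d i1 i3) (val d i2 i3); first by lia.
    by split=> //; apply: ord5P.
split=> [a b ab|b]; have [bi|/dg[h1 h2]] := eqVneq b i4.
- by move: ab; rewrite bi col4; move: a; apply: ord5P; rewrite ?mxE ?mulr0.
- exact: h1.
- by rewrite bi col4 mxE /= mulr1.
- exact: h2.
Qed.

(** By [orbit_face_word] the element [g] is a word in the facets times some [d]
    that preserves the time axis, a diagonal matrix of signs.  Off the diagonal the word vanishes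
    modulo 4, so the off-diagonal sums [gram] are even; by [gram_diag] and
    [gram_time] the diagonal ones are then even too, the word is 1 modulo 4, and
    so is [d]. *)
Lemma Gamma4_face_word g : g \in Gamma 4 -> exists2 fs, all face fs & g = word fs.
Proof.
move=> gG; have /GammaP[X gX] := gG.
have gE a b : val g a b = (a == b)%:R + 4 * X a b by rewrite gX !mxE.
(* The sign that moves [g basept] to the future sheet of the hyperboloid. *)
pose eps : int := if 0 < val g i4 i4 then 1 else -1.
have eps1 : eps * eps = 1 by rewrite /eps; case: ifP.
have xE i : (eps *: act g basept) i 0 = eps * val g i i4.
  by rewrite mxE basept_delta act_delta.
have [|||fs afs xw] := @orbit_face_word (eps *: act g basept).
- by rewrite ldotZl ldotZr ldot_act ldot_basept mxE /= mulrA eps1.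
- by rewrite xE gE /eps gE eqxx; case: ifP; lia.
- move=> i ni; rewrite xE gE (negPf ni); apply/dvdzP.
  by exists (eps * 2 * X i i4); rewrite add0r; ring.
exists fs => //.
have f1 : {in fs, forall f, ldot f f = 1}.
  by move=> f /(allP afs) /faceP[].
have [Y wY] := word_gram f1.
pose d := ((word fs)^-1 * g)%g.
have gd : g = (word fs * d)%g by rewrite /d mulgA mulgV mul1g.
have dt : act d basept = eps *: basept.
  by rewrite /d actM -[act g basept]scale1r -eps1 -scalerA xw actZ actK.
have [|offd dd] := axis_diagonal _ eps1 dt.
  by apply: gpredM; [rewrite gpredV word_Gamma2 | exact: Gamma_dvd gG].
have gw a b : val g a b = val (word fs) a b * val d b b.
  rewrite gd /= mxE (bigD1 b) //= big1 ?addr0 // => k kb.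
  by rewrite offd // mulr0.
have ww a b : val (word fs) a b = val g a b * val d b b.
  by rewrite gw -mulrA dd mulr1.
have pm b : val d b b = 1 \/ val d b b = -1 by have := dd b; nia.
have goff a b : a != b -> (2 %| gram fs a b)%Z.
  move=> ab; have := ww a b; rewrite wY gE (negPf ab) => e; apply/dvdzP.
  by case: (pm b) e => -> e; [exists (X a b - Y a b) | exists (- X a b - Y a b)]; lia.
have d1 b : (2 %| gram fs b b)%Z -> val d b b = 1.
  move=> /dvdzP[q gq]; have := ww b b; rewrite wY gE eqxx gq.
  by case: (pm b) => -> //; lia.
have dE b : val d b b = 1.
  have [->|nb] := eqVneq b i4; apply: d1; last first.
    have := gram_diag b afs; have := goff b i4 nb.
    by move=> /dvdzP[q ->] /dvdzP[r e]; apply/dvdzP; exists (q + r); lia.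
  have := gram_time afs.
  have := (goff i0 i1 isT); have := (goff i0 i2 isT); have := (goff i0 i3 isT).
  have := (goff i1 i2 isT); have := (goff i1 i3 isT); have := (goff i2 i3 isT).
  move=> /dvdzP[q1 ->] /dvdzP[q2 ->] /dvdzP[q3 ->] /dvdzP[q4 ->] /dvdzP[q5 ->] /dvdzP[q6 ->].
  move=> /dvdzP[q e].
  by apply/dvdzP; exists (q - q1 - q2 - q3 - q4 - q5 - q6); lia.
by apply/val_inj/matrixP => a b; rewrite gw dE mulr1.
Qed.

(** * Sums of finitely supported functions on Z^5 *)

Definition finitely_supported (F : vect -> int) : Prop :=
  exists r : seq vect, forall e, e \notin r -> F e = 0.

Definition fsum (F : vect -> int) : int := \sum_(e \in [set: vect]%classic) F e.

Lemma fsumE (F : vect -> int) (r : seq vect) : uniq r -> (forall e, e \notin r -> F e = 0) ->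
  fsum F = \sum_(e <- r) F e.
Proof.
move=> ur h; rewrite /fsum (fsbigE r) //; last by move=> e _; exact: h.
by apply: eq_bigl => e; rewrite in_setT.
Qed.

Lemma fsumD F G : finitely_supported F -> finitely_supported G ->
  fsum (fun e => F e + G e) = fsum F + fsum G.
Proof.
move=> [r rF] [s sG]; pose u := undup (r ++ s).
have out e : e \notin u -> e \notin r /\ e \notin s.
  by rewrite mem_undup mem_cat negb_or => /andP.
rewrite !(@fsumE _ u) ?undup_uniq // ?big_split // => e /out[er es].
- by rewrite sG.
- by rewrite rF.
- by rewrite rF // sG.
Qed.

Lemma fsum_reindex (h k : vect -> vect) F : cancel h k -> cancel k h ->
  fsum (fun e => F (h e)) = fsum F.
Proof. by move=> hk kh; rewrite /fsum [RHS](reindex_fsbigT h) //; exists k. Qed.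

Lemma fsum_pair F (f : vect) : f != - f -> (forall e, e != f -> e != - f -> F e = 0) ->
  fsum F = F f + F (- f).
Proof.
move=> ff h; rewrite (@fsumE _ [:: f; - f]) ?big_cons ?big_nil ?addr0 //=.
  by rewrite inE ff.
by move=> e; rewrite !inE negb_or => /andP[e1 e2]; exact: h.
Qed.

Lemma finite_box (t : int) : exists r : seq vect, forall e : vect,
  (forall i, `|e i 0| <= t) -> e \in r.
Proof.
have [t0|t0] := ltP t 0; first by exists [::] => e /(_ i0); have := normr_ge0 (e i0 0); lia.
pose n := (absz t * 2)%N.
pose dec (m : 'cV['I_n.+1]_5) : vect := \col_i ((m i 0 : nat)%:Z - t).
exists (codom dec) => e h; apply/codomP; exists (\col_i inord (absz (e i 0 + t))).
apply: vectP => i; rewrite !mxE inordK; have := h i; rewrite /n; lia.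
Qed.

(** * Walls *)

(** Every facet is a wall, and so are its images under the facet reflections.
    The odd last coordinate separates a wall from its opposite modulo 4, and
    keeps the orbit of [basept] under Gamma(2) off the walls. *)
Definition wall (e : vect) : bool := (ldot e e == 1) && ~~ (2 %| e i4 0%R)%Z.

Lemma wallP (e : vect) : reflect (ldot e e = 1 /\ ~~ (2 %| e i4 0%R)%Z) (wall e).
Proof. by apply: (iffP andP) => -[/eqP a b]. Qed.

(** Write e = (b; u) and y = (a; t).  If e separates y from the base point, then
    u t <= a.b, and Cauchy-Schwarz gives u^2 t^2 <= (t^2 - 1) (u^2 + 1), that is
    u^2 + 1 <= t^2, so all coordinates of e are at most t. *)
Lemma crossing_bound (y : vect) : ldot y y = -1 -> 0 < y i4 0 ->
  exists r : seq vect, forall e, ldot e e = 1 -> 0 < e i4 0 -> 0 <= ldot e y -> e \in r.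
Proof.
move=> yy t0; have [r rP] := finite_box (y i4 0).
exists r => e ee u0 ey; apply: rP.
have c := sdot_cauchy e y; rewrite !ldot_sdot in yy ee ey.
have ut : e i4 0 * y i4 0 <= sdot e y by lia.
have sq : (e i4 0 * y i4 0) * (e i4 0 * y i4 0) <= sdot e y * sdot e y.
  by apply: ler_pM => //; apply: mulr_ge0; lia.
have se : sdot e e = 1 + e i4 0 * e i4 0 by lia.
have sy : sdot y y = y i4 0 * y i4 0 - 1 by lia.
have bnd : sdot e e <= y i4 0 * y i4 0.
  rewrite se sy in c *; move: c sq; move: (sdot e y * sdot e y) (e i4 0) (y i4 0) => k u t.
  by move=> h1 h2; have := le_trans h2 h1; lia.
have sqb (z : int) : z * z <= y i4 0 * y i4 0 -> `|z| <= y i4 0.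
  by move=> h; nia.
move: bnd se; rewrite /sdot => bnd se.
have [s0 s1] := (mulrr_ge0 (e i0 0), mulrr_ge0 (e i1 0)).
have [s2 s3] := (mulrr_ge0 (e i2 0), mulrr_ge0 (e i3 0)).
by apply: ord5P; apply: sqb; lia.
Qed.

(** The base point and its mirror image in the facet [f] are separated by no wall
    other than that of [f]: write e = (b; u); separation gives 3 u <= 2 f.b, and
    then u^2 <= 8 by Cauchy-Schwarz, so that u = 1, |b|^2 = 2 and f.b >= 2. *)
Lemma wall_next_to_basept (e f : vect) : wall e -> face f -> 0 < e i4 0 ->
  (act (refl 2 f) e) i4 0 <= 0 -> e = f.
Proof.
move=> /wallP[ee eodd] ff u0; rewrite act_refl ?face_refl //.
have [f4 _] := faceP _ ff.
rewrite face_ldot //.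
have -> : (e - (2 * (sdot f e - e i4 0)) *: f) i4 0 = 3 * e i4 0 - 2 * sdot f e.
  by rewrite !mxE f4; ring.
move=> cr; have c := sdot_cauchy f e; rewrite face_sdot // in c.
have se : sdot e e = 1 + e i4 0 * e i4 0 by rewrite ldot_sdot in ee; lia.
have u1 : e i4 0 = 1.
  have u3 : e i4 0 < 3.
    by rewrite ltNge; apply/negP => u3; nia.
  by lia.
have fe : 2 <= sdot f e by lia.
have dd : sdot (e - f) (e - f) <= 0.
  have -> : sdot (e - f) (e - f) = sdot e e + sdot f f - 2 * sdot f e.
    by rewrite /sdot !mxE; ring.
  by rewrite se face_sdot // u1; lia.
apply: vectP; move: dd {c cr se fe}; rewrite /sdot !mxE.
move=> /sum4_sqr_le0[z0 z1 z2 z3].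
by apply: ord5P; rewrite ?u1 ?f4 //; apply/eqP; rewrite -subr_eq0; apply/eqP.
Qed.

Lemma face_wall f : face f -> wall f.
Proof. by move=> /faceP[f4 ff]; apply/wallP; rewrite f4. Qed.

Lemma wallN e : wall (- e) = wall e.
Proof. by rewrite /wall ldotNl ldotNr opprK mxE dvdzE abszN -dvdzE. Qed.

Lemma refl_time f e : face f -> act (refl 2 f) e i4 0 = e i4 0 - 2 * ldot f e.
Proof.
by move=> ff; rewrite act_refl ?face_refl // !mxE; move/faceP: ff => [-> _]; rewrite mulr1.
Qed.

Lemma refl_face_self f : face f -> act (refl 2 f) f = - f.
Proof.
move=> ff; rewrite act_refl ?face_refl //.
by apply: vectP => i; rewrite !mxE; ring.
Qed.

Lemma refl_invol f e : face f -> act (refl 2 f) (act (refl 2 f) e) = e.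
Proof. by move=> ff; rewrite -{1}(reflV (face_refl ff)) actK. Qed.

Lemma wall_refl f e : face f -> wall (act (refl 2 f) e) = wall e.
Proof.
move=> ff; rewrite /wall ldot_act refl_time //; congr (_ && ~~ _).
by apply/idP/idP => /dvdzP[q h]; apply/dvdzP;
  [exists (q + ldot f e) | exists (q - ldot f e)]; lia.
Qed.

Lemma word_time_pos fs : all face fs -> 0 < act (word fs) basept i4 0.
Proof.
elim: fs => [_|f fs IH /= /andP[ff /IH h]]; first by rewrite /act mul1mx mxE.
rewrite actM refl_time //; apply: face_descent_pos => //.
by rewrite ldot_act ldot_basept mxE.
Qed.

Lemma wall_avoids e g : wall e -> g \in Gamma 2 -> ldot e (act g basept) != 0.
Proof.
move=> /wallP[_ e4] /GammaP[X gX]; apply: contra e4 => /eqP.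
rewrite /act gX mulmxDl mul1mx -scalemxAl ldotDr ldotZr ldot_basept => h.
by apply/dvdzP; exists (ldot e (X *m basept)); lia.
Qed.

(** * Counting wall crossings *)

(** The homomorphisms are functions on the whole of [O41Z], additive on T only, so
    that they restrict to smaller subgroups as they stand. *)
Definition rationally_trivial (T : {pred O41Z}) (x : O41Z) : Prop :=
  forall psi : O41Z -> int,
    (forall y z, y \in T -> z \in T -> psi (y * z)%g = psi y + psi z) -> psi x = 0.

Section CrossingParity.
Variable P : pred vect.
Hypothesis PN : forall e, wall e -> P (- e) = P e.
Hypothesis Prefl : forall f e, face f -> wall e -> P (act (refl 2 f) e) = P e.

(* The invariant family of walls whose crossings are counted. *)
Let C (e : vect) : bool := wall e && P e.

Let CN e : C (- e) = C e.
Proof. by rewrite /C wallN; case: (boolP (wall e)) => //= /PN ->. Qed.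

Let Crefl f e : face f -> C (act (refl 2 f) e) = C e.
Proof. by move=> ff; rewrite /C wall_refl //; case: (boolP (wall e)) => //= /Prefl ->. Qed.

Let Cword fs e : all face fs -> C (act (word fs) e) = C e.
Proof.
elim: fs e => [|f fs IH] e /=; first by rewrite /act mul1mx.
by move=> /andP[ff /IH h]; rewrite actM Crefl.
Qed.

Let CGamma g e : g \in Gamma 4 -> C (act g e) = C e.
Proof. by move=> /Gamma4_face_word[fs afs ->]; exact: Cword. Qed.

(* Whether [e] separates [basept] from [y]; the sign of its last coordinate
   selects one of the two opposite normals of a wall. *)
Let cross (y e : vect) : int := (C e && (0 < e i4 0) && (0 < ldot e y))%:R.

Let crossings (g : O41Z) : int := fsum (cross (act g basept)).

Let Cwall e : C e -> wall e. Proof. by move=> /andP[]. Qed.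

Let cross_bound fs : all face fs ->
  exists r : seq vect, forall e, e \notin r -> cross (act (word fs) basept) e = 0.
Proof.
move=> afs; have [|r h] := @crossing_bound (act (word fs) basept) _ (word_time_pos afs).
  by rewrite ldot_act ldot_basept mxE.
exists r => e; rewrite /cross.
case: (boolP (_ && _)) => // /andP[/andP[/Cwall /wallP[ee _] e4] ey].
by rewrite h // ltW.
Qed.

(* Reflecting in [f] the walls that separate [basept] from r_f (word fs) basept
   gives those that separate r_f basept from (word fs) basept.  By
   [wall_next_to_basept] replacing r_f basept with [basept] only changes the
   status of the wall of [f]. *)
Let crossings_cons f fs : face f -> all face fs ->
  exists k, crossings (word (f :: fs)) = crossings (word fs) + (P f)%:R + 2 * k.
Proof.
move=> ff afs; set y := act (word fs) basept.
pose c' e : int := (C e && (0 < act (refl 2 f) e i4 0) && (0 < ldot e y))%:R.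
have fy : ldot f y != 0 := wall_avoids (face_wall ff) (word_Gamma2 afs).
have ff' : f != - f.
  by apply/eqP => /matrixP/(_ i4 0); rewrite mxE; move/faceP: ff => [-> _].
have fN : C (- f) = P f by rewrite CN /C face_wall.
have Cf : C f = P f by rewrite /C face_wall.
have f4 : f i4 0 = 1 by case/faceP: ff.
have e1 : crossings (word (f :: fs)) = fsum c'.
  rewrite /crossings -(fsum_reindex (h := act (refl 2 f)) (k := act (refl 2 f))) //.
  - congr fsum; apply: functional_extensionality_dep => e.
    by rewrite /cross /c' Crefl // actM ldot_act.
  - by move=> e; exact: refl_invol.
  - by move=> e; exact: refl_invol.
pose G e := c' e - cross y e.
have G0 e : e != f -> e != - f -> G e = 0.
  move=> ef eNf; rewrite /G /c' /cross; case: (boolP (C e)) => //= /Cwall we.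
  have we' : wall (act (refl 2 f) e) by rewrite wall_refl.
  suff -> : (0 < act (refl 2 f) e i4 0) = (0 < e i4 0) by rewrite subrr.
  apply/idP/idP => h; rewrite ltNge; apply/negP => h'.
    case/eqP: eNf; rewrite -[e]opprK; congr (- _).
    have e4 : e i4 0 < 0.
      by rewrite lt_neqAle h' andbT; apply: contraNneq (proj2 (wallP _ we)) => ->.
    apply: wall_next_to_basept => //; first by rewrite wallN.
      by rewrite mxE oppr_gt0.
    by rewrite -scaleN1r actZ mxE mulN1r oppr_le0 ltW.
  by case/eqP: ef; exact: wall_next_to_basept h'.
have cf e : c' e = cross y e + G e by rewrite /G addrC subrK.
have -> : crossings (word (f :: fs)) = crossings (word fs) + fsum G.
  rewrite e1 -fsumD; first by congr fsum; apply: functional_extensionality_dep.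
    exact: cross_bound.
  exists [:: f; - f] => e; rewrite !inE negb_or => /andP[]; exact: G0.
rewrite (fsum_pair ff' G0) /G /c' /cross fN Cf refl_face_self //.
have -> : act (refl 2 f) (- f) = f by rewrite -[in LHS]refl_face_self // refl_invol.
rewrite !mxE f4 ldotNl; case: (P f); last by exists 0; rewrite /=; ring.
have [fy0|fy0|fy0] := ltgtP (ldot f y) 0.
- by exists 0; rewrite /= oppr_gt0 fy0 /=; ring.
- by exists (-1); rewrite /= oppr_gt0 (ltNge _ 0) (ltW fy0) /=; ring.
- by rewrite fy0 eqxx in fy.
Qed.

Let crossings_word fs : all face fs -> exists k, crossings (word fs) = (count P fs)%:Z + 2 * k.
Proof.
elim: fs => [_|f fs IH /= /andP[ff afs]].
  exists 0; rewrite /crossings /fsum fsbig1 // => e _; rewrite /cross.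
  by rewrite /act mul1mx ldot_basept oppr_gt0; case: (ltgtP (e i4 0) 0); rewrite ?andbF.
have [k e] := IH afs; have [l ->] := crossings_cons ff afs.
by exists (k + l); rewrite e PoszD; case: (P f); ring.
Qed.

(* A coorientation of the family [C] invariant under Gamma(4): exactly one of two
   opposite walls has last coordinate 1 modulo 4. *)
Let D (e : vect) : bool := C e && (e i4 0%R == 1 %[mod 4])%Z.

Let DGamma g e : g \in Gamma 4 -> D (act g e) = D e.
Proof.
move=> gG; rewrite /D CGamma //; congr (_ && _).
have /GammaP[X gX] := gG.
have -> : act g e i4 0 = e i4 0 + 4 * (X *m e) i4 0.
  by rewrite /act gX mulmxDl mul1mx -scalemxAl mxE [X in _ + X]mxE.
by move: (e i4 0) ((X *m e) i4 0) => a b; lia.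
Qed.

Let H (z : int) : int := (0 < z)%R%:R.

(* The signed crossing of [e] by a path from [basept] to [g basept]. *)
Let flow (g : O41Z) (e : vect) : int :=
  (D e)%:R * (H (ldot e (act g basept)) - H (ldot e basept)).

Let phi (g : O41Z) : int := fsum (flow g).

Let Gamma4_sub2 g : g \in Gamma 4 -> g \in Gamma 2.
Proof. exact: Gamma_dvd. Qed.

Let flowE g e : g \in Gamma 4 ->
  flow g e = (D e)%:R * cross (act g basept) e - (D e)%:R * cross (act g basept) (- e).
Proof.
move=> gG; rewrite -mulrBr /flow; case: (boolP (D e)) => [/andP[Ce _]|]; last by rewrite !mul0r.
congr (_ * _); rewrite /H /cross CN Ce ldotNl mxE ldot_basept /=.
have we := Cwall Ce; have := wall_avoids we (Gamma4_sub2 gG); have [_] := wallP _ we.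
move: (e i4 0) (ldot e _) => u z u2 z0.
have : u != 0 by apply: contraNneq u2 => ->.
by rewrite !oppr_gt0; case: (ltgtP u 0); case: (ltgtP z 0) => // h; rewrite h eqxx in z0.
Qed.

Let flow_bound g : g \in Gamma 4 -> finitely_supported (flow g) /\
   (finitely_supported (fun e => (D e)%:R * cross (act g basept) e) /\
    finitely_supported (fun e => (D e)%:R * cross (act g basept) (- e))).
Proof.
move=> gG; have [fs afs gw] := Gamma4_face_word gG.
have [r h] := cross_bound afs; rewrite -gw in h.
have h' e : e \notin map -%R r -> cross (act g basept) (- e) = 0.
  by move=> er; apply: h; apply: contra er => er; rewrite -[e]opprK map_f.
split; last split; last 2 first.
- by exists r => e /h ->; rewrite mulr0.
- by exists (map -%R r) => e /h' ->; rewrite mulr0.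
exists (r ++ map -%R r) => e; rewrite mem_cat negb_or flowE // => /andP[/h -> /h' ->].
by rewrite mulr0 subr0.
Qed.

(* A path from [basept] to g h basept can be taken through [g basept]; its second
   half is the image under [g] of a path from [basept] to [h basept]. *)
Let phiM g h : g \in Gamma 4 -> h \in Gamma 4 -> phi (g * h)%g = phi g + phi h.
Proof.
move=> gG hG; have [fg _] := flow_bound gG; have [[r fh] _] := flow_bound hG.
rewrite /phi -[fsum (flow h)](fsum_reindex (h := act g^-1%g) (k := act g)).
- rewrite -fsumD //; last first.
    exists (map (act g) r) => e er; apply: fh; apply: contra er => er.
    by rewrite -(actVK g e) map_f.
  congr fsum; apply: functional_extensionality_dep => e.
  rewrite /flow DGamma ?gpredV // actM -!mulrDr; congr (_ * _).
  by rewrite !ldot_actl invgK; ring.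
- by move=> e; exact: actVK.
- by move=> e; exact: actK.
Qed.

Let phi_crossings g : g \in Gamma 4 -> exists k, crossings g = phi g + 2 * k.
Proof.
move=> gG; have [_ [f1 f2]] := flow_bound gG.
have f3 : finitely_supported (fun e => - ((D e)%:R * cross (act g basept) (- e))).
  by have [r h] := f2; exists r => e /h ->; rewrite oppr0.
exists (fsum (fun e => (D e)%:R * cross (act g basept) (- e))).
have e1 : phi g = fsum (fun e => (D e)%:R * cross (act g basept) e) +
    fsum (fun e => - ((D e)%:R * cross (act g basept) (- e))).
  rewrite -fsumD // /phi; congr fsum; apply: functional_extensionality_dep => e.
  exact: flowE.
have e2 : fsum (fun e => - ((D e)%:R * cross (act g basept) (- e))) +
    fsum (fun e => (D e)%:R * cross (act g basept) (- e)) = 0.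
  rewrite -fsumD // /fsum fsbig1 // => e _; exact: addNr.
have e3 : crossings g = fsum (fun e => (D e)%:R * cross (act g basept) e) +
    fsum (fun e => (D e)%:R * cross (act g basept) (- e)).
  rewrite -[X in _ + X](fsum_reindex (h := -%R) (k := -%R)); try by move=> e; exact: opprK.
  rewrite -fsumD //; last first.
    have [r h] := f2; exists (map -%R r) => e er; apply: h; apply: contra er => er.
    by rewrite -[e]opprK map_f.
  congr fsum; apply: functional_extensionality_dep => e.
  rewrite opprK -mulrDl /D CN /cross; case: (boolP (C e)) => [Ce|]; last by rewrite mulr0.
  have [_ e4] := wallP _ (Cwall Ce).
  rewrite -[LHS]mul1r; congr (_ * _); rewrite mxE /=.
  move: (e i4 0) e4 => u u2; have [] : (u = 1 %[mod 4])%Z \/ (- u = 1 %[mod 4])%Z by lia.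
    by move=> h; rewrite h eqxx (_ : (- u == 1 %[mod 4])%Z = false) //; lia.
  by move=> h; rewrite h eqxx (_ : (u == 1 %[mod 4])%Z = false) //; lia.
by rewrite e3 e1; move: e2; lia.
Qed.

(** The signed count [phi] is a homomorphism, hence zero here, and it has the
    parity of the unsigned count, which is that of the letters in the family. *)
Lemma even_wall_crossings fs : all face fs -> word fs \in Gamma 4 ->
  rationally_trivial (Gamma 4) (word fs) -> ~~ odd (count P fs).
Proof.
move=> afs gG /(_ phi phiM) p0.
have [k e] := crossings_word afs; have [l] := phi_crossings gG.
by rewrite e p0; lia.
Qed.
End CrossingParity.

(** * Rational commutators of Gamma(4) *)

(** The image of a wall under s, which is integral by [wall_even]. *)
Definition srefl (e : vect) : vect := e - (ldot sroot e %/ 2)%Z *: sroot.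

(** Squares preserve parities, so the sum of the spatial coordinates has the parity
    of the sum of their squares, which is 1 plus an odd square. *)
Lemma wall_even (e : vect) : wall e -> (2 %| ldot sroot e)%Z.
Proof.
move=> /wallP[]; rewrite !ldotE !mxE /= => ee e4.
have [k0 e0] := sqz_parity (e i0 0%R); have [k1 e1] := sqz_parity (e i1 0%R).
have [k2 e2] := sqz_parity (e i2 0%R); have [k3 e3] := sqz_parity (e i3 0%R).
have [k4 e4'] := sqz_parity (e i4 0%R).
rewrite e0 e1 e2 e3 e4' in ee.
by rewrite !mul1r mul0r subr0; lia.
Qed.

Lemma sreflE e : wall e -> 2 *: srefl e = Smx *m e.
Proof.
move=> /wall_even h; rewrite SmxE scalerBr scalerA.
by congr (_ - _ *: _); lia.
Qed.

Lemma vect_half (x y : vect) : 2 *: x = 2 *: y -> x = y.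
Proof.
move=> /matrixP h; apply: vectP => i; move: (h i 0).
by rewrite [LHS]mxE [RHS]mxE; exact: mulfI.
Qed.

Lemma sreflN e : wall e -> srefl (- e) = - srefl e.
Proof.
by move=> we; apply: vect_half; rewrite sreflE ?wallN // mulmxN -sreflE // scalerN.
Qed.

Lemma srefl_refl f e : face f -> wall e ->
  srefl (act (refl 2 f) e) = srefl e - (2 * ldot f e) *: srefl f.
Proof.
move=> ff we; apply: vect_half.
have wf := face_wall ff.
rewrite sreflE ?wall_refl // act_refl ?face_refl // mulmxBr -scalemxAr.
rewrite -(sreflE we) -(sreflE wf).
by rewrite [RHS]scalerBr; congr (_ - _); rewrite !scalerA; congr (_ *: _); ring.
Qed.

Lemma srefl_norm e : wall e -> ldot (srefl e) (srefl e) = 1.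
Proof.
move=> we; have /wallP[ee _] := we.
suff: 4 * ldot (srefl e) (srefl e) = 4 by lia.
transitivity (ldot (2 *: srefl e) (2 *: srefl e)); first by rewrite ldotZl ldotZr; ring.
by rewrite sreflE // Smx_adj mulmxA SmxK mul_scalar_mx ldotZr ee.
Qed.

Lemma word_srefl fs x : all face fs ->
  4 *: act (word (map srefl fs)) x = Smx *m act (word fs) (Smx *m x).
Proof.
elim: fs => [_|f fs IH /= /andP[ff /IH{}IH]].
  by rewrite /act !mul1mx mulmxA SmxK mul_scalar_mx.
rewrite !actM; set y := act (word (map srefl fs)) x in IH *.
have wf := face_wall ff.
have -> : act (word fs) (Smx *m x) = Smx *m y.
  apply: vect_half; apply: vect_half; rewrite !scalerA.
  by rewrite [RHS]scalemxAr IH mulmxA SmxK mul_scalar_mx.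
have sf2 : 2 * ldot (srefl f) (srefl f) = 2 by rewrite srefl_norm.
rewrite (act_refl y sf2).
rewrite [act (refl 2 f) _](act_refl _ (face_refl ff)).
have -> : 2 * ldot f (Smx *m y) = 4 * ldot (srefl f) y.
  by rewrite -Smx_adj -sreflE // ldotZl; ring.
rewrite mulmxBr mulmxA SmxK mul_scalar_mx -[in RHS]scalemxAr -(sreflE wf).
rewrite [LHS]scalerBr; congr (_ - _).
by rewrite !scalerA; congr (_ *: _); ring.
Qed.

Lemma sconj_word fs : all face fs -> word fs \in Gamma 4 ->
  sconj (word fs) = word (map srefl fs).
Proof.
move=> afs gG; apply: O41Z_ext => x; apply: vect_half; apply: vect_half.
rewrite !scalerA [RHS]word_srefl // /act scalemxAl sconj_scale //.
by rewrite !mulmxA.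
Qed.

Lemma gram_parity (a b : 'I_5) fs :
  ~~ odd (count (fun f : vect => ~~ (2 %| f a 0%R * f b 0%R)%Z) fs) ->
  (2 %| gram fs a b)%Z.
Proof.
suff [k ->] : exists k, gram fs a b =
    (count (fun f : vect => ~~ (2 %| f a 0%R * f b 0%R)%Z) fs)%:Z + 2 * k by lia.
elim: fs => [|f fs [k e]] /=; first by exists 0; rewrite /gram big_nil.
rewrite gram_cons e PoszD; move: (f a 0 * f b 0) => z.
by case: (boolP (2 %| z)%Z) => z2;
  [exists (k + (z %/ 2)%Z) | exists (k + ((z - 1) %/ 2)%Z)];
  rewrite /=; move: (count _ _) => n; lia.
Qed.

(** For each pair of indices a, b, the family of walls e such that the coordinates
    a and b of s e are both odd is invariant under the facet reflections, which
    change s e by even multiples of integral vectors. *)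
Lemma sconj_rationally_trivial g : g \in Gamma 4 ->
  rationally_trivial (Gamma 4) g -> sconj g \in Gamma 4.
Proof.
move=> gG gt; have [fs afs gw] := Gamma4_face_word gG; rewrite gw in gG gt *.
rewrite sconj_word //.
have n1 : {in map srefl fs, forall f, ldot f f = 1}.
  by move=> _ /mapP[f /(allP afs) /face_wall ff ->]; exact: srefl_norm.
have [Y wY] := word_gram n1.
apply/Gamma_predP => a b.
have /dvdzP[q gq] : (2 %| gram (map srefl fs) a b)%Z.
  apply: gram_parity; rewrite count_map.
  pose odd_ab (f : vect) := ~~ (2 %| f a 0%R * f b 0%R)%Z.
  apply: (even_wall_crossings (P := preim srefl odd_ab)) => //=.
    by move=> e we; rewrite /odd_ab sreflN // !mxE mulrNN.
  move=> f e ff we; rewrite srefl_refl //; congr (~~ _).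
  move: (srefl f) (srefl e) (ldot f e) => u v l; rewrite !mxE.
  have -> : (v a 0 + - (2 * l * u a 0)) * (v b 0 + - (2 * l * u b 0)) =
     v a 0 * v b 0 + 2 * (l * (2 * l * u a 0 * u b 0 - v a 0 * u b 0 - u a 0 * v b 0)) by ring.
  by rewrite rpredDr // dvdz_mulr.
by apply/dvdzP; exists (q + Y a b) => /=; rewrite mxE wY gq !mxE; lia.
Qed.

(** * The tower *)

Fixpoint tower_pred (j : nat) : {pred O41Z} :=
  if j is i.+1 then
    fun g => (g \in tower_pred i) &&
             `[< forall k, sconj (k * g * k^-1)%g \in tower_pred i >]
  else Gamma_pred 4.

Lemma tower_predS j g : reflect
  (g \in tower_pred j /\ forall k, sconj (k * g * k^-1)%g \in tower_pred j)
  (g \in tower_pred j.+1).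
Proof.
apply: (iffP andP) => [[h /asboolP]|[h1 h2]] //.
by split=> //; apply/asboolP.
Qed.

Lemma tower_sub_Gamma j : {subset tower_pred j <= Gamma 4}.
Proof. by elim: j => // j IH g /tower_predS[/IH]. Qed.

Lemma conjgMK (k x y : O41Z) : (k * (x * y) * k^-1 = (k * x * k^-1) * (k * y * k^-1))%g.
Proof. by rewrite !mulgA mulgVK. Qed.

Lemma conjgVK (k x : O41Z) : (k * x^-1 * k^-1 = (k * x * k^-1)^-1)%g.
Proof. by rewrite !invgM invgK mulgA. Qed.

Lemma tower_closed j : group_closed (tower_pred j).
Proof.
elim: j => [|j [IH1 IH2]].
  by split=> [|x y hx hy]; [exact: Gamma_pred1 | apply: Gamma_predM => //; exact: Gamma_predV].
have G g k : g \in tower_pred j -> (k * g * k^-1)%g \in Gamma 4.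
  by move=> /tower_sub_Gamma h; exact: GammaJ.
split=> [|x y /tower_predS[hx kx] /tower_predS[hy ky]].
  by apply/tower_predS; split=> // k; rewrite mulg1 mulgV sconj1.
apply/tower_predS; split=> [|k]; first exact: IH2.
rewrite conjgMK conjgVK sconjM ?sconjV ?gpredV ?G //.
by apply: IH2.
Qed.

Section TowerSubgroup.
Variable j : nat.
HB.instance Definition _ := isMulClosed.Build O41Z (tower_pred j)
  (group_closedM (tower_closed j)).
HB.instance Definition _ := isMul1Closed.Build O41Z (tower_pred j)
  (proj1 (tower_closed j)).
HB.instance Definition _ := isInvClosed.Build O41Z (tower_pred j)
  (group_closedV (tower_closed j)).
Definition tower : groupClosed O41Z := tower_pred j.
End TowerSubgroup.

Lemma towerJ j k g : g \in tower j -> (k * g * k^-1)%g \in tower j.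
Proof.
elim: j k g => [|j IH] k g; first exact: GammaJ.
move=> /tower_predS[hg kg]; apply/tower_predS; split=> [|l]; first exact: IH.
by have := kg (l * k)%g; rewrite invgM !mulgA.
Qed.

Lemma Gamma_sub_tower j g : g \in Gamma (4 ^ j.+1) -> g \in tower j.
Proof.
elim: j g => [//|j IH] g hg; apply/tower_predS; split=> [|k].
  apply: IH; apply: (Gamma_dvd _ hg).
  by rewrite [X in (_ %| X)%N]expnS; exact: dvdn_mull.
by apply: IH; apply: sconj_sub; rewrite -expnS; exact: GammaJ.
Qed.

Lemma rationally_trivial_sub (S T : {pred O41Z}) g : {subset S <= T} ->
  rationally_trivial S g -> rationally_trivial T g.
Proof. by move=> ST h psi psiM; apply: h => y z /ST yT /ST; exact: psiM. Qed.

Lemma rationally_trivial_morph (S T : {pred O41Z}) (f : O41Z -> O41Z) g :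
    {in S, forall y, f y \in T} -> {in S &, {morph f : y z / (y * z)%g}} ->
  rationally_trivial S g -> rationally_trivial T (f g).
Proof.
move=> fT fM h psi psiM; apply: (h (psi \o f)) => y z yS zS /=.
by rewrite fM // psiM // fT.
Qed.

Lemma rationally_trivialJ j k g :
  rationally_trivial (tower j) g -> rationally_trivial (tower j) (k * g * k^-1)%g.
Proof.
apply: (rationally_trivial_morph (f := fun g => (k * g * k^-1)%g)) => [y|y z _ _].
  exact: towerJ.
exact: conjgMK.
Qed.

(** Normality turns the case j + 1 into two uses of the case j, for g and for the
    image of g under the homomorphism sending y to k s y s k^-1, which maps
    T_(j+1) to T_j. *)
Lemma tower_sconj j g : g \in tower j -> rationally_trivial (tower j) g ->
  sconj g \in tower j.
Proof.
elim: j g => [|j IH] g gT tg; first exact: sconj_rationally_trivial.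
have /tower_predS[gj kj] := gT.
apply/tower_predS; split=> [|k].
  by apply: IH => //; apply: rationally_trivial_sub tg => x /tower_predS[].
have sub y : y \in tower j.+1 -> sconj y \in tower j.
  by move=> /tower_predS[_ /(_ 1%g)]; rewrite mul1g invg1 mulg1.
apply: IH; first by apply/towerJ/sub.
apply/rationally_trivialJ.
apply: rationally_trivial_morph tg => // y z yT zT.
by rewrite sconjM ?(tower_sub_Gamma yT) ?(tower_sub_Gamma zT).
Qed.

Lemma tower_rational j g : g \in tower j -> rationally_trivial (tower j) g ->
  g \in tower j.+1.
Proof.
move=> gT tg; apply/tower_predS; split=> // k.
by apply: tower_sconj; [exact: towerJ | exact: rationally_trivialJ].
Qed.

Lemma rational_commutator_trivial j (x : subgroup (tower j)) :
  rational_commutator x -> rationally_trivial (tower j) (val x).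
Proof.
move=> rx psi psiM; apply: (@intr_inj rat).
apply: (@rational_commutator_hom _ (fun y : subgroup (tower j) => (psi (val y))%:~R)) rx.
by move=> y z; rewrite -intrD -psiM // ?(valP y) ?(valP z).
Qed.

(** * The intersection of the tower *)

Definition cusp : vect := vec5 0 0 0 1 1.
(** The reflection in this vector of norm 2 sends 2 s cusp = (-1,-1,-1,1;2) back
    to [cusp], so that its product with s halves [cusp]. *)
Definition cusp_root : vect := vec5 (-1) (-1) (-1) 0 1.

(** Let r be the reflection in [cusp_root] and h = r s, which halves [cusp].  Then
    s r g r^-1 s is h^-1 g h, and (h^-1 g h cusp, cusp) = (g h cusp, h cusp) is a
    quarter of (g cusp, cusp). *)
Lemma tower_descent j g : g \in tower j -> (4 ^+ j %| ldot (act g cusp) cusp)%Z.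
Proof.
elim: j g => [|j IH] g; first by rewrite expr0 dvd1z.
move=> /tower_predS[gj /(_ (refl 1 cusp_root))/[dup] /IH dv _].
set h := (refl 1 cusp_root * g * (refl 1 cusp_root)^-1)%g in dv.
have av2 : 1 * ldot cusp_root cusp_root = 2 by rewrite ldotE !mxE.
have Spv : act (refl 1 cusp_root) (Smx *m cusp) = cusp.
  rewrite act_refl // SmxE; apply: vectP.
  by apply: ord5P; rewrite !ldotE !mxE.
have hG : h \in Gamma 4 by apply/GammaJ/(tower_sub_Gamma gj).
suff -> : ldot (act g cusp) cusp = 4 * ldot (act (sconj h) cusp) cusp.
  by rewrite exprS dvdz_mul.
rewrite -ldotZl /act scalemxAl sconj_scale // -[_ *m Smx *m cusp]mulmxA.
rewrite -[Smx *m _ *m _]mulmxA Smx_adj -/(act h _).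
by rewrite /h !actM reflV // Spv ldot_actl reflV // Spv.
Qed.

(** The combination of [x] and [y] that cancels the last coordinate is spatial and
    isotropic, hence zero. *)
Lemma isotropic_colinear x y : ldot x x = 0 -> ldot y y = 0 -> ldot x y = 0 ->
  y i4 0 *: x = x i4 0 *: y.
Proof.
move=> xx yy xy; set z := y i4 0 *: x - x i4 0 *: y.
have zz : ldot z z = 0 by rewrite !ldot_lin (ldotC y) xx yy xy; ring.
have z4 : z i4 0 = 0 by rewrite !mxE; ring.
apply/eqP; rewrite -subr_eq0 -/z; apply/eqP; apply: vectP.
move: zz; rewrite ldotE z4 mul0r subr0 => zz.
move: (lexx (0 : int)); rewrite -{1}zz => /sum4_sqr_le0[z0 z1 z2 z3].
by apply: ord5P; rewrite [RHS]mxE.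
Qed.

Lemma dvdz_expn_all_eq0 (b : nat) (a : int) : (1 < b)%N ->
  (forall j, (b%:Z ^+ j %| a)%Z) -> a = 0.
Proof.
move=> b1 h; apply/eqP; case: eqP => // /eqP a0; have := h `|a|%N.
rewrite dvdzE abszX absz_nat => /dvdn_leq; rewrite absz_gt0 => /(_ a0).
by rewrite leqNgt ltn_expl.
Qed.

(** [g] and its inverse multiply [cusp] by integers with product 1, and the first
    one is 1 modulo 4. *)
Lemma tower_cap_fix g : (forall j, g \in tower j) -> act g cusp = cusp.
Proof.
move=> gT.
have pp : ldot cusp cusp = 0 by rewrite ldotE !mxE.
have p4 : cusp i4 0 = 1 by rewrite !mxE.
have col h : (forall j, h \in tower j) -> act h cusp = act h cusp i4 0 *: cusp.
  move=> hT; have h0 : ldot (act h cusp) cusp = 0.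
    by apply: (@dvdz_expn_all_eq0 4) => // j; exact: tower_descent.
  rewrite -[LHS]scale1r -p4 -(isotropic_colinear pp _ (etrans (ldotC _ _) h0)) //.
  by rewrite ldot_act.
have gVT j : (g^-1)%g \in tower j by rewrite gpredV; exact: gT.
have := actVK g cusp; rewrite (col _ gVT) actZ (col _ gT) scalerA.
move=> /matrixP/(_ i4 0); rewrite mxE p4 mulr1.
have /GammaP[X gX] : g \in Gamma 4 by exact: (gT 0).
have -> : act g cusp i4 0 = 1 + 4 * (X *m cusp) i4 0.
  by rewrite /act gX mulmxDl mul1mx -scalemxAl mxE p4 mxE.
move: (X *m cusp) => w ab; rewrite (_ : w i4 0 = 0) ?mulr0 ?addr0 ?scale1r //.
have unit4 (a b : int) : b * (1 + 4 * a) = 1 -> a = 0.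
  move=> e; have: (1 + 4 * a %| 1)%Z by apply/dvdzP; exists b.
  by rewrite dvdz1; lia.
exact: unit4 ab.
Qed.

Lemma tower_cap_fixJ g k : (forall j, g \in tower j) -> act g (act k cusp) = act k cusp.
Proof.
move=> gT; rewrite -[RHS](congr1 (act k) (@tower_cap_fix (k^-1 * g * k)%g _)).
  by rewrite -!actM !mulgA mulgV mul1g.
by move=> j; have := towerJ k^-1%g (gT j); rewrite invgK.
Qed.

(** Reflections in vectors of norm 1 and 2 carry [cusp] to enough isotropic vectors
    to span twice the lattice. *)
Lemma tower_cap_trivial g : (forall j, g \in tower j) -> g = 1%g.
Proof.
move=> gT.
have fixr c e (x : vect) :
    c * ldot e e = 2 -> x = cusp - (c * ldot e cusp) *: e -> act g x = x.
  by move=> ce ->; rewrite -act_refl // tower_cap_fixJ.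
have f0 : act g (vec5 1 0 0 0 1) = vec5 1 0 0 0 1.
  apply: (fixr 1 (vec5 (-1) 0 0 1 0)); first by rewrite ldotE !mxE.
  by apply: vectP; apply: ord5P; rewrite ldotE !mxE.
have f1 : act g (vec5 0 1 0 0 1) = vec5 0 1 0 0 1.
  apply: (fixr 1 (vec5 0 (-1) 0 1 0)); first by rewrite ldotE !mxE.
  by apply: vectP; apply: ord5P; rewrite ldotE !mxE.
have f2 : act g (vec5 0 0 1 0 1) = vec5 0 0 1 0 1.
  apply: (fixr 1 (vec5 0 0 (-1) 1 0)); first by rewrite ldotE !mxE.
  by apply: vectP; apply: ord5P; rewrite ldotE !mxE.
have f3 : act g (vec5 0 0 0 (-1) 1) = vec5 0 0 0 (-1) 1.
  apply: (fixr 2 (vec5 0 0 0 1 0)); first by rewrite ldotE !mxE.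
  by apply: vectP; apply: ord5P; rewrite ldotE !mxE.
have f4 : act g cusp = cusp := tower_cap_fix gT.
apply: O41Z_ext => x; rewrite {2}/act mul1mx.
have x2 : 2 *: x = (2 * x i0 0) *: vec5 1 0 0 0 1 + (2 * x i1 0) *: vec5 0 1 0 0 1
  + (2 * x i2 0) *: vec5 0 0 1 0 1
  + (x i4 0 - x i0 0 - x i1 0 - x i2 0 - x i3 0) *: vec5 0 0 0 (-1) 1
  + (x i4 0 - x i0 0 - x i1 0 - x i2 0 + x i3 0) *: cusp.
  by apply: vectP; apply: ord5P; rewrite !mxE /=; ring.
have: act g (2 *: x) = 2 *: x by rewrite x2 !actD !actZ f0 f1 f2 f3 f4.
rewrite actZ => /matrixP e; apply: vectP => i; move: (e i 0).
by rewrite [LHS]mxE [RHS]mxE; exact: mulfI.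
Qed.

(** The coset of x modulo T_j only depends on the reduction of x modulo a level
    [N] of T_j. *)
Lemma tower_finite_index j : finite_index (tower j) (Gamma 4).
Proof.
split; first exact: tower_sub_Gamma.
have [N N0 NT] : exists2 N, (0 < N)%N & {subset Gamma N <= tower j}.
  by exists (4 ^ j.+1)%N; [rewrite expn_gt0 | exact: Gamma_sub_tower].
pose red (x : O41Z) : 'M['I_N.-1.+1]_5 :=
  map_mx (fun z => inord `|(z %% N)%Z|%N) (val x).
pose coset (x : O41Z) := ((fun h => (x * h)%g) @` [set` tower j])%classic.
pose pick (m : 'M['I_N.-1.+1]_5) : set O41Z :=
  coset (xget 1%g [set x | red x = m])%classic.
apply: (@sub_finite_set _ _ (range pick)); last exact: finite_image.
move=> _ [x _ <-]; exists (red x) => //; rewrite /pick.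
set y := xget _ _; have yx : red y = red x.
  by apply: (@xgetPex _ 1%g [set z | red z = red x]%classic); exists x.
have xyN : (x^-1 * y)%g \in Gamma N.
  have dv i k : (N %| val y i k - val x i k)%Z.
    rewrite -eqz_mod_dvd; move/matrixP/(_ i k)/(congr1 val): yx.
    rewrite /red [X in val X]mxE [X in _ = val X]mxE.
    have lt (z : int) : (`|(z %% N)%Z| < N.-1.+1)%N by rewrite prednK //; lia.
    by rewrite /= !inordK //; lia.
  have [Z yZ] : exists Z, val y = val x + N%:Z *: Z.
    exists (\matrix_(i, k) ((val y i k - val x i k) %/ N)%Z).
    apply/matrixP => i k; rewrite [RHS]mxE [X in _ + X]mxE [X in _ * X]mxE.
    by rewrite [X in _ + X]mulrC divzK // addrC subrK.
  apply/GammaP; exists (val x^-1%g *m Z).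
  by rewrite /= yZ mulmxDr mulVmx ?O41Z_unitmx // -scalemxAr.
have xyT := NT _ xyN.
rewrite /coset; apply/seteqP; split=> _ [h hT <-].
  by exists (x^-1 * y * h)%g; [exact: gpredM | rewrite !mulgA mulgV mul1g].
exists ((x^-1 * y)^-1 * h)%g; first by apply: gpredM => //; rewrite gpredV.
by rewrite invgM invgK !mulgA mulgV mul1g.
Qed.

Theorem proposition3p5 :
  exists T : nat -> groupClosed O41Z,
    RFRS_tower (Gamma 4) T /\ (forall j, congruence_subgroup (T j)).
Proof.
exists tower; split; last first.
  by move=> j; exists (4 ^ j.+1)%N; [rewrite expn_gt0 | exact: Gamma_sub_tower].
split=> // [j|j g||j x rx].
- exact: tower_finite_index.
- by move=> /tower_predS[].
- rewrite eqEsubset; split=> [g gT|_ -> j _]; last exact: gpred1.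
  by apply: tower_cap_trivial => j; exact: gT.
- by apply: tower_rational; [exact: valP | exact: rational_commutator_trivial].
Qed.
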